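(* Let $X$ be a non-singular, projective, non-hyperelliptic curve of genus $g\ge3$ over an algebraically closed field $k$ of characteristic $\ne2$, with canonical ideal $I_X\subset S$ generated by quadrics $\omega^tA_i\omega$, $1\le i\le r$, and let $G$ be a finite subgroup of $\mathrm{Aut}(X)$. Let $[f]\in H^1(X,\mathcal T_X)^G$ be the class of a map $f:I_X\to S/I_X$ modulo $\mathrm{Im}\,\psi$. For each element $\sigma\in G$ there is a matrix $B_\sigma[f]\in M_g(k)$, depending on $f$, which defines a class in $M_g(k)/\langle\mathbb I_g\rangle$ satisfying the cocycle condition $$B_{\sigma\tau}[f]=B_\sigma[f]+\mathrm{Ad}(\sigma)B_\tau[f]+\lambda(\sigma,\tau)\mathbb I_g\quad\text{for all }\sigma,\tau\in G,\ \text{for some }\lambda(\sigma,\tau)\in k,$$ such that $$\delta_G(f)(\sigma):A_i\mapsto A_i\,B_\sigma[f]+B_\sigma[f]^t\,A_i\mod\langle A_1,\ldots,A_r\rangle\qquad(1\le i\le r).$$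
   Context: $S=\mathrm{Sym}\,H^0(X,\Omega_X)=k[\omega_1,\ldots,\omega_g]$, $\omega=(\omega_1,\ldots,\omega_g)^t$; $i:X\hookrightarrow\mathbb P^{g-1}$ is the canonical embedding and $I_X$ is its homogeneous ideal. $A_1,\ldots,A_r$ ($r=\binom{g-2}{2}$) are linearly independent symmetric $g\times g$ matrices over $k$ whose quadratic forms generate $I_X$; symmetric matrices are identified with quadratic forms, and $\langle A_1,\ldots,A_r\rangle$ is the $k$-span, i.e. the degree 2 part of $I_X$. $H^0(X,\mathcal N_{X/\mathbb P^{g-1}})$ is identified with degree-preserving $S$-linear maps $I_X\to S/I_X$. For $B\in M_g(k)$, $\psi_B\in\mathrm{Hom}_S(I_X,S/I_X)$ is given by $\omega^tA_i\omega\mapsto\omega^t(A_iB+B^tA_i)\omega\bmod I_X$; the map $\psi:B\mapsto\psi_B$ has kernel the scalar matrices $\langle\mathbb I_g\rangle$ and image $H^0(X,i^*\mathcal T_{\mathbb P^{g-1}})$. The short exact sequence $$0\to H^0(X,i^*\mathcal T_{\mathbb P^{g-1}})\to H^0(X,\mathcal N_{X/\mathbb P^{g-1}})\to H^1(X,\mathcal T_X)\to0$$ identifies $H^1(X,\mathcal T_X)$ with $H^0(X,\mathcal N_{X/\mathbb P^{g-1}})/\mathrm{Im}\,\psi$. $\rho:G\to\mathrm{GL}_g(k)$ is the homomorphism, coming from the action of $G$ on $H^0(X,\Omega_X)$, such that $\sigma\in G$ acts on $S$ by the substitution $\omega\mapsto\rho(\sigma^{-1})\omega$, i.e. on matrices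 of quadratic forms by $T(\sigma)A=\rho(\sigma^{-1})^tA\rho(\sigma^{-1})$; $\mathrm{Ad}(\sigma)B=\rho(\sigma)B\rho(\sigma^{-1})$; and ${}^\sigma f=\sigma\circ f\circ\sigma^{-1}$. The connecting map $\delta_G:H^1(X,\mathcal T_X)^G\to H^1(G,H^0(X,i^*\mathcal T_{\mathbb P^{g-1}}))$ is represented by the 1-cocycle $\delta_G(f)(\sigma)={}^\sigma f-f$. *)

(* Defs.v *)
From HB Require Import structures.
From mathcomp Require Import all_boot all_order all_algebra all_fingroup.
From mathcomp Require Import mxrepresentation.
From mathcomp Require Import mpoly.

Set Implicit Arguments.
Unset Strict Implicit.
Unset Printing Implicit Defensive.

Import GRing.Theory.
Local Open Scope ring_scope.

(* Integral projective varieties in the classical language.  The variety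
   X in P^(n-1) over the algebraically closed field k is presented by its
   generic point: a field K over k (through iota) and homogeneous coordinates
   x : 'I_n -> K, where X is the set of common zeros of the homogeneous forms
   that vanish at x.  K is the function field of X as soon as it is generated
   by the ratios x_i / x_j. *)
Section Variety.

Variables (k : closedFieldType) (K : fieldType) (iota : {rmorphism k -> K}).
Variables (n : nat) (x : 'I_n -> K).
Implicit Types (P : 'I_n -> k) (F H : {mpoly k[n]}).

(* The homogeneous ideal of X; a polynomial that is not homogeneous belongs to
   it when all its homogeneous components vanish at the generic point. *)
Definition hom_ideal F : Prop :=
  forall d : nat, mmap iota x (pihomog mdeg d F) = 0.

(* P is a vector of homogeneous coordinates of a closed point of X. *)
Definition closed_point P : Prop :=
  (exists i, P i != 0) /\
  (forall d F, F \is d.-homog -> mmap iota x F = 0 -> F.@[P] = 0).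

(* The local ring O_{X,P} and its maximal ideal, as subsets of K. *)
Definition in_local_ring P (z : K) : Prop :=
  exists d F H, [/\ F \is d.-homog, H \is d.-homog, H.@[P] != 0
                  & z = mmap iota x F / mmap iota x H].

Definition in_max_ideal P (z : K) : Prop :=
  exists d F H, [/\ F \is d.-homog, H \is d.-homog, H.@[P] != 0, F.@[P] = 0
                  & z = mmap iota x F / mmap iota x H].

Definition is_function_field : Prop :=
  (exists i, x i != 0) /\
  (forall z : K, exists d F H,
      [/\ F \is d.-homog, H \is d.-homog, mmap iota x H != 0
        & z = mmap iota x F / mmap iota x H]).

Definition transcendence_degree_one : Prop :=
  exists t : K, ~ algebraicOver iota t /\
    forall y : K, exists2 p : {mpoly k[2]},
      p != 0 & mmap iota (tnth [tuple t; y]) p = 0.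

(* All local rings, of dimension one, are regular: the maximal ideal is
   generated by one element. *)
Definition nonsingular_curve : Prop :=
  forall P, closed_point P ->
    exists2 t, in_max_ideal P t
             & forall z, in_max_ideal P z ->
                 exists2 a, in_local_ring P a & z = a * t.

Definition nonsingular_projective_curve : Prop :=
  [/\ is_function_field, transcendence_degree_one & nonsingular_curve].

(* An automorphism of X, given by the k-automorphism it induces on K: it
   permutes the local rings of the closed points. *)
Definition curve_automorphism (s : K -> K) : Prop :=
  [/\ bijective s, (forall c, s (iota c) = iota c),
      (forall P, closed_point P -> exists2 Q, closed_point Q
         & forall z, in_local_ring P z <-> in_local_ring Q (s z))
    & (forall Q, closed_point Q -> exists2 P, closed_point P
         & forall z, in_local_ring P z <-> in_local_ring Q (s z))].

End Variety.

(* X and Y are presented in the same field K, by x and y.  The rational map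
   given by y restricts to an isomorphism of X onto Y (so that X -> P^(m-1) is
   a closed embedding with image Y) iff X and Y have the same local rings
   inside K. *)
Definition closed_embedding (k : closedFieldType) (K : fieldType)
    (iota : {rmorphism k -> K}) (n m : nat) (x : 'I_n -> K) (y : 'I_m -> K) :=
  (forall P, closed_point iota x P -> exists2 Q, closed_point iota y Q
     & forall z, in_local_ring iota x P z <-> in_local_ring iota y Q z) /\
  (forall Q, closed_point iota y Q -> exists2 P, closed_point iota x P
     & forall z, in_local_ring iota x P z <-> in_local_ring iota y Q z).

(* A morphism of degree 2 from X to P^1 is an element t of K with
   [K : k(t)] = 2, i.e. K has a k(t)-basis of the form 1, y. *)
Section Hyperelliptic.

Variables (k : closedFieldType) (K : fieldType) (iota : {rmorphism k -> K}).

Definition in_simple_ext (t z : K) : Prop :=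
  exists p q : {poly k}, (map_poly iota q).[t] != 0 /\
    z = (map_poly iota p).[t] / (map_poly iota q).[t].

Definition hyperelliptic : Prop :=
  exists t y : K, ~ in_simple_ext t y /\
    forall z, exists a b : K,
      [/\ in_simple_ext t a, in_simple_ext t b & z = a + b * y].

End Hyperelliptic.

Section Differentials.

Variables (k : closedFieldType) (K : fieldType) (iota : {rmorphism k -> K}).

Definition derivation (M : lmodType K) (D : K -> M) : Prop :=
  [/\ forall a b, D (a + b) = D a + D b,
      forall a b, D (a * b) = a *: D b + b *: D a
    & forall c, D (iota c) = 0].

(* (Omega, d) is the module of Kaehler differentials of K over k. *)
Definition kaehler_differentials (Omega : lmodType K) (d : K -> Omega) : Prop :=
  derivation d /\
  forall (M : lmodType K) (D : K -> M), derivation D ->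
    exists2 h : {linear Omega -> M}, (forall z, D z = h (d z))
      & forall h' : {linear Omega -> M}, (forall z, D z = h' (d z)) -> h' =1 h.

Variables (Omega : lmodType K) (d : K -> Omega) (n : nat) (x : 'I_n -> K).

(* H^0(X, Omega_X): the stalk of Omega_X at P is the O_{X,P}-submodule of
   Omega generated by the differentials of the elements of O_{X,P}. *)
Definition regular_differential (w : Omega) : Prop :=
  forall P, closed_point iota x P ->
    exists (m : nat) (a b : 'I_m -> K),
      [/\ forall i, in_local_ring iota x P (a i),
          forall i, in_local_ring iota x P (b i)
        & w = \sum_i a i *: d (b i)].

Definition regular_differentials_basis (g : nat) (omega : 'I_g -> Omega) :=
  [/\ forall i, regular_differential (omega i),
      forall c : 'I_g -> k, \sum_i iota (c i) *: omega i = 0 ->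
        forall i, c i = 0
    & forall w, regular_differential w ->
        exists c : 'I_g -> k, w = \sum_i iota (c i) *: omega i].

(* (w_1 : ... : w_g) = (omega_1 : ... : omega_g): the generic point of the
   canonical image. *)
Definition canonical_coordinates (g : nat) (omega : 'I_g -> Omega)
    (w : 'I_g -> K) : Prop :=
  exists2 eta : Omega, eta != 0 & forall i, omega i = w i *: eta.

End Differentials.

(* Homogeneous ideals I of S = k[omega_1, ..., omega_g], quadrics, and the
   space Hom_S(I, S/I)_0. *)
Section Normal.

Variables (k : closedFieldType) (g : nat).
Local Notation S := {mpoly k[g]}.
Implicit Types (M A B C : 'M[k]_g) (F H p : S) (f : S -> S).

Definition quad A : S := \sum_i \sum_j A i j *: ('X_i * 'X_j).

Definition subst_lin M F : S := F \mPo [tuple \sum_j M i j *: 'X_j | i < g].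

Variable I : S -> Prop.

Definition eq_mod F H : Prop := I (F - H).

Definition generated_by_quadrics (r : nat) (A : 'I_r -> 'M[k]_g) : Prop :=
  forall F, I F <-> exists c : 'I_r -> S, F = \sum_i c i * quad (A i).

(* A map I -> S/I is represented by f : S -> S, of which only the restriction
   to I and the values modulo I are relevant; two such f represent the same
   map when they are related by eq_hom. *)
Definition eq_hom f f' : Prop := forall F, I F -> eq_mod (f F) (f' F).

(* f represents a degree-preserving S-linear map. *)
Definition normal_section f : Prop :=
  [/\ forall F H, I F -> I H -> eq_mod (f (F + H)) (f F + f H),
      forall p F, I F -> eq_mod (f (p * F)) (p * f F)
    & forall d F, I F -> F \is d.-homog ->
        exists2 H, H \is d.-homog & eq_mod (f F) H].

Variables (r : nat) (A : 'I_r -> 'M[k]_g).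

(* f represents psi_B, the S-linear map determined by its values on the
   generators omega^t A_i omega. *)
Definition represents_psi B f : Prop :=
  normal_section f /\
  forall i, eq_mod (f (quad (A i))) (quad (A i *m B + B^T *m A i)).

Definition in_image_psi f : Prop :=
  exists B, exists2 h, represents_psi B h & eq_hom f h.

Definition in_span C : Prop := exists c : 'I_r -> k, C = \sum_i c i *: A i.

(* The map represented by f sends the quadric M to the class of N in symmetric
   matrices modulo the span of the A_i. *)
Definition maps_mod_span f M N : Prop :=
  exists C, [/\ C^T = C, eq_mod (f (quad M)) (quad C) & in_span (C - N)].

End Normal.

Section Equivariance.

Variables (k : closedFieldType) (g : nat) (G : finGroupType).
Variable rho : mx_representation k [set: G] g.
Local Notation S := {mpoly k[g]}.
Implicit Types (f : S -> S) (s : G).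

(* The substitution omega |-> rho(s^-1) omega; on matrices of quadratic forms
   it is M |-> rho(s^-1)^t M rho(s^-1). *)
Definition actS s (F : S) : S := subst_lin (rho s^-1%g) F.

Definition conj_map s f : S -> S := fun F => actS s (f (actS s^-1%g F)).

Definition delta f s : S -> S := fun F => conj_map s f F - f F.

Definition Ad s (B : 'M[k]_g) : 'M[k]_g := rho s *m B *m rho s^-1%g.

(* The class of f in H^1(X, T_X) = H^0(X, N) / Im psi is G-invariant. *)
Definition invariant_class (I : S -> Prop) (r : nat) (A : 'I_r -> 'M[k]_g) f :=
  forall s, in_image_psi I A (delta f s).

End Equivariance.

(* act is a faithful action of G on X by automorphisms, and actO the induced
   action on differentials.  act s is (s^-1)^*, so that both are left
   actions. *)
Definition automorphism_group (k : closedFieldType) (K : fieldType)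
    (iota : {rmorphism k -> K}) (n : nat) (x : 'I_n -> K) (G : finGroupType)
    (act : G -> {rmorphism K -> K}) : Prop :=
  [/\ forall s, curve_automorphism iota x (act s),
      forall (s t : G) z, act (s * t)%g z = act s (act t z)
    & forall s t : G, act s =1 act t -> s = t].

Definition induced_on_differentials (K : fieldType) (Omega : lmodType K)
    (d : K -> Omega) (G : finGroupType) (act : G -> {rmorphism K -> K})
    (actO : G -> {additive Omega -> Omega}) : Prop :=
  forall s a b, actO s (a *: d b) = act s a *: d (act s b).

(* Main.v *)
Require Import Defs.
From HB Require Import structures.
From mathcomp Require Import all_boot all_order all_algebra all_fingroup.
From mathcomp Require Import mxrepresentation.
From mathcomp Require Import mpoly.
From mathcomp Require Import ring.
From mathcomp Require boolp classical_sets.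

(** A matrix [B] acts on [S] through the derivation [vector_field B] sending
    the column [omega] to [B omega].  On a quadric it is
    [A |-> A B + B^T A], so a representative of [psi_B] agrees modulo the
    ideal [I] with [vector_field B] on the whole of [I]
    ([represents_psi_vector_field]).  Invariance of the class of [f] therefore
    provides, for each [s], a matrix [B s] such that
    [delta f s = vector_field (B s)] as maps [I -> S/I].  Two facts then give
    the result.

    - The map [s |-> delta f s] is a cocycle on the nose ([deltaM]), and
      conjugation by [s] turns [vector_field B] into [vector_field (Ad s B)]
      ([actS_vector_field_quad]).  This needs [I] to be stable under [G]
      ([hom_ideal_actS]): the generic point [act s w] and the point
      [rho (s^-1) w] are proportional, because both are coordinates of the
      transformed differentials.  Hence the vector field of
      [B (s t) - B s - Ad s (B t)] maps [I] into [I].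

    - A matrix [C] whose vector field maps [I] into [I] is scalar
      ([vector_field_preserving_ideal_scalar]).  This yields both the
      uniqueness of [B s] modulo scalars and the cocycle condition, and it is
      where the geometry of the curve enters.

    For the second fact, such a [C] defines a derivation [D] of the function
    field [K] that preserves all the local rings, that is, a global vector
    field on [X] ([induced_derivation]).  The contraction of [D] with each
    regular differential [omega i = w i *: eta] is regular everywhere, hence
    constant; if one of these constants were nonzero, the [w i] would all be
    [k]-multiples of one element, against the independence of the [omega i].
    So [D] contracts to 0 with [eta], and [D = 0] because the derivations of
    [K] form a line ([no_global_vector_field]).  Finally [D = 0] says that the
    generic point [w] is an eigenvector of [C]; its eigenvalue is algebraic
    over [k], hence in [k], and the independence of the [w i] makes [C]
    scalar.

    Two facts on curves carry this argument.  An element of [K] that is not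
    constant has a pole at some closed point ([exists_pole]): a subalgebra
    maximal among those that contain the inverse of the element but not the
    element itself is a valuation ring with residue field [k], and the residues
    of suitably normalized coordinates are the pole.  A derivation that kills a
    uniformizer [t] at one closed point vanishes
    ([derivation_zero_at_uniformizer]): expanding [z] in powers of [t] shows
    that its values are divisible by every power of [t].  The second fact
    replaces separability arguments and is valid in every characteristic. *)

Set Implicit Arguments.
Unset Strict Implicit.
Unset Printing Implicit Defensive.

Import GRing.Theory.
Local Open Scope ring_scope.

(** * Morphisms out of a field of fractions *)

Section FractionMorphism.

Variables (R : idomainType) (E : fieldType) (e : {rmorphism R -> E}).
Hypothesis inj_e : injective e.

Local Notation "p %:F" := (FracField.tofrac p).

Lemma fraction_ratio (x : {fraction R}) :
  exists n d : R, d != 0 /\ x = n%:F / d%:F.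
Proof.
rewrite -[x]generic_quotient.reprK; move: (generic_quotient.repr x) => y.
have nz := denom_ratioP y; exists (frac y).1, (frac y).2; split=> //.
apply: (@mulIf _ (frac y).2%:F); first by rewrite tofrac_eq0.
rewrite divfK ?tofrac_eq0 //; unlock FracField.tofrac.
rewrite -[LHS]FracField.pi_mul; apply/generic_quotient.eqmodP => /=.
rewrite FracField.equivfE /FracField.mulf /=.
by rewrite !numden_Ratio ?oner_eq0 ?mulf_neq0 ?oner_eq0 // !mulr1 mulrC.
Qed.

(** The value of a fraction, computed from a chosen numerator and denominator;
    [fraction_eval_ratio] shows that the choice does not matter. *)
Definition fraction_eval (x : {fraction R}) : E :=
  let y := sval (boolp.cid (fraction_ratio x)) in
  let z := sval (boolp.cid (svalP (boolp.cid (fraction_ratio x)))) in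
  e y / e z.

Lemma fraction_eval_ratio n d : d != 0 ->
  fraction_eval (n%:F / d%:F) = e n / e d.
Proof.
move=> nz_d; rewrite /fraction_eval; case: boolp.cid => n' /= hn'.
case: boolp.cid => d' /= [nz_d' eq_nd].
have nz0 : forall c, c != 0 -> e c != 0.
  by move=> c; apply: contra => /eqP ec0; apply/eqP/inj_e; rewrite ec0 rmorph0.
apply/eqP; rewrite eqr_div ?nz0 // -!rmorphM; apply/eqP; congr (e _).
apply/eqP; rewrite -tofrac_eq !tofracM; apply/eqP.
by apply/esym/eqP; rewrite -eqr_div ?tofrac_eq0 //; apply/eqP.
Qed.

Lemma fraction_eval_zmod : zmod_morphism fraction_eval.
Proof.
have nz0 : forall c, c != 0 -> e c != 0.
  by move=> c; apply: contra => /eqP ec0; apply/eqP/inj_e; rewrite ec0 rmorph0.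
move=> x y; have [n [d [nz_d ->]]] := fraction_ratio x.
have [m [c [nz_c ->]]] := fraction_ratio y.
rewrite -mulNr -tofracN addf_div ?tofrac_eq0 // -!tofracM -tofracD.
rewrite !fraction_eval_ratio ?mulf_neq0 // rmorphD !rmorphM rmorphN.
by rewrite -mulNr addf_div ?nz0.
Qed.

Lemma fraction_eval_monoid : monoid_morphism fraction_eval.
Proof.
split=> [|x y].
  rewrite -[X in fraction_eval X]divr1 -tofrac1 fraction_eval_ratio ?oner_eq0 //.
  by rewrite !rmorph1 divr1.
have [n [d [nz_d ->]]] := fraction_ratio x.
have [m [c [nz_c ->]]] := fraction_ratio y.
rewrite mulf_div -!tofracM !fraction_eval_ratio ?mulf_neq0 //.
by rewrite !rmorphM mulf_div.
Qed.

Lemma fraction_morphism :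
  exists phi : {rmorphism {fraction R} -> E}, forall p, phi p%:F = e p.
Proof.
pose madd := GRing.isZmodMorphism.Build _ _ fraction_eval fraction_eval_zmod.
pose mmul := GRing.isMonoidMorphism.Build _ _ fraction_eval fraction_eval_monoid.
pose phi : {rmorphism {fraction R} -> E} :=
  HB.pack fraction_eval madd mmul.
exists phi => p.
by rewrite -[p%:F]divr1 -tofrac1 /= fraction_eval_ratio ?oner_eq0 // rmorph1 divr1.
Qed.

Lemma clear_denominators (q : {poly {fraction R}}) :
  exists (c : R) (p : {poly R}),
    c != 0 /\ c%:F *: q = map_poly (@FracField.tofrac R) p.
Proof.
elim/poly_ind: q => [|q a [c [p [nz_c Dp]]]].
  by exists 1, 0; rewrite oner_eq0 scaler0 rmorph0.
have [n [d [nz_d ->]]] := fraction_ratio a.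
exists (c * d), (d *: p * 'X + (c * n)%:P); rewrite mulf_neq0 //; split=> //.
rewrite rmorphD [in RHS]rmorphM /= map_polyX map_polyC map_polyZ /= -Dp.
rewrite scalerDr -!scalerAl scalerA -tofracM (mulrC d); congr (_ + _).
rewrite -mul_polyC -polyCM; congr (_%:P).
by rewrite !tofracM mulrA mulrAC mulfK ?tofrac_eq0 // mulrC.
Qed.

End FractionMorphism.

(** * Algebraic dependence in transcendence degree one *)

Section AlgebraicDependence.

Variables (k : closedFieldType) (K : fieldType) (iota : {rmorphism k -> K}).

(** Evaluation at [s] of polynomials with coefficients in [k], as a ring
    morphism; two of these composed as [(map_poly (eval1 s) q).[u]] evaluate a
    polynomial in two variables at the pair [(s, u)]. *)
Definition eval1 (s : K) : {rmorphism {poly k} -> K} :=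
  horner_eval s \o map_poly iota.

Lemma eval1E s q : eval1 s q = (map_poly iota q).[s].
Proof. by []. Qed.

Lemma eval1C s a : eval1 s a%:P = iota a.
Proof. by rewrite eval1E map_polyC hornerC. Qed.

Lemma eval_swapXY (q : {poly {poly k}}) (s u : K) :
  (map_poly (eval1 s) (swapXY q)).[u] = (map_poly (eval1 u) q).[s].
Proof.
pose v := map_poly (map_poly iota) q.
have eval1_map r x y : (map_poly (eval1 x) r).[y] =
    (map_poly (horner_eval x) (map_poly (map_poly iota) r)).[y].
  by rewrite -map_poly_comp.
have Dv : map_poly (map_poly iota) (swapXY q) = swapXY v by rewrite -swapXY_map.
rewrite !eval1_map Dv -(horner_swapXY (swapXY v) s) swapXYK.
by rewrite -(horner_swapXY v u) horner2_swapXY.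
Qed.

Lemma bivariate_poly_of_mpoly (p : {mpoly k[2]}) (s u : K) : p != 0 ->
  exists2 q : {poly {poly k}}, q != 0 &
    (map_poly (eval1 s) q).[u] = mmap iota (tnth [tuple s; u]) p.
Proof.
move=> nz_p; pose i0 : 'I_2 := ord0; pose i1 : 'I_2 := lift ord0 ord0.
pose q : {poly {poly k}} := \sum_(m <- msupp p) (p@_m *: 'X^(m i0)) *: 'X^(m i1).
have eq_m (m m' : 'X_{1..2}) : m i0 = m' i0 -> m i1 = m' i1 -> m = m'.
  move=> e0 e1; apply/mnmP => i; have [->|->] // : i = i0 \/ i = i1.
  by case: i => [[|[|[]]] lti] //; [left|right]; apply/val_inj.
exists q.
  have [m m_p] : exists m, m \in msupp p.
    case Dp: (msupp p) (msupp_eq0 p) => [|m ms] /=; first by rewrite (negPf nz_p).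
    by exists m; rewrite mem_head.
  apply: contraTneq m_p => q0; rewrite mcoeff_msupp negbK.
  have /polyP/(_ (m i1))/polyP/(_ (m i0)) := q0; rewrite !coef0 => /eqP.
  have -> // : (q`_(m i1))`_(m i0) = p@_m.
  rewrite coef_sum coef_sum [in RHS](mpolyE p) raddf_sum /=.
  apply: eq_bigr => m' _; rewrite coefZ coefXn mcoeffZ mcoeffX.
  have [e1|ne1] := eqVneq (m i1) (m' i1).
    rewrite mulr1 coefZ coefXn; congr (_ * _%:R).
    have [e0|ne0] := eqVneq (m i0) (m' i0); first by rewrite (eq_m m m') ?eqxx.
    by case: (eqVneq m' m) ne0 => [->|//]; rewrite eqxx.
  rewrite mulr0 coef0; case: (eqVneq m' m) ne1 => [->|_ _]; first by rewrite eqxx.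
  by rewrite mulr0.
rewrite /q rmorph_sum /= horner_sum; apply: eq_bigr => m _.
rewrite map_polyZ hornerZ map_polyXn hornerXn eval1E map_polyZ hornerZ.
rewrite map_polyXn hornerXn -mulrA; congr (_ * _).
by rewrite /mmap1 2!big_ord_recl big_ord0 mulr1.
Qed.

Lemma algebraic_in_k (c : K) : algebraicOver iota c -> exists a, c = iota a.
Proof.
case=> p nz_p; have [r ->] := closed_field_poly_normal p.
rewrite map_polyZ /= rootZ ?fmorph_eq0 ?lead_coef_eq0 //.
rewrite rmorph_prod /= rootE horner_prod prodf_seq_eq0 => /hasP[a _] /=.
rewrite rmorphB /= map_polyX map_polyC /= hornerXsubC subr_eq0 => /eqP ->.
by exists a.
Qed.

Lemma eval1_inj s : ~ algebraicOver iota s -> injective (eval1 s).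
Proof.
move=> tr_s; apply: raddf_inj => q q0.
have [//|nz_q] := eqVneq q 0; case: tr_s; exists q => //.
by apply/rootP.
Qed.

Hypothesis trdeg1 : transcendence_degree_one iota.

(** The exchange property.  Let [t] be a transcendental element over which
    everything is algebraic.  A relation between [s] and [t], read the other
    way round, makes [t] algebraic over [k(s)]; as [u] is algebraic over
    [k(t)], transitivity makes it algebraic over [k(s)].  The field [k(s)] is
    realized as the field of fractions of [k[X]]. *)
Lemma algebraic_over_transcendental (s u : K) : ~ algebraicOver iota s ->
  exists2 q : {poly {poly k}}, q != 0 & (map_poly (eval1 s) q).[u] = 0.
Proof.
move=> tr_s; have inj_s := eval1_inj tr_s.
have [t [tr_t alg_t]] := trdeg1; have inj_t := eval1_inj tr_t.
have [phi Dphi] := fraction_morphism inj_s.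
have alg_phi p : p != 0 -> root (map_poly (eval1 s) p) t -> algebraicOver phi t.
  move=> nz_p pt0; exists (map_poly (@FracField.tofrac _) p).
    rewrite map_poly_eq0_id0 // tofrac_eq0 lead_coef_eq0 //.
  by rewrite -map_poly_comp (eq_map_poly (g := eval1 s)).
have phi_t : algebraicOver phi t.
  have [p nz_p pst] := alg_t s.
  have [q nz_q Dq] := bivariate_poly_of_mpoly t s nz_p.
  apply: (alg_phi (swapXY q)); rewrite ?swapXY_eq0 //.
  by rewrite rootE eval_swapXY Dq pst.
have [p nz_p ptu] := alg_t u.
have [q nz_q Dq] := bivariate_poly_of_mpoly t u nz_p; rewrite ptu in Dq.
have /integral_algebraic[] : integralOver phi u.
  apply: (@integral_root _ _ _ (map_poly (eval1 t) q)).
  - by rewrite map_poly_eq0_id0 // raddf_eq0 // lead_coef_eq0.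
  - exact/rootP.
  - move=> _ /(nthP 0)[i _ <-]; rewrite coef_map_id0 ?rmorph0 //.
    apply: integral_horner; last exact/integral_algebraic.
    move=> _ /(nthP 0)[j _ <-]; rewrite coef_map /= -(eval1C s) -Dphi.
    exact: integral_id.
move=> r nz_r ru0; have [c [r' [nz_c Dr']]] := clear_denominators r.
exists r'.
  apply: contraNneq nz_r => r'0; move: Dr'; rewrite r'0 rmorph0 => /eqP.
  by rewrite scaler_eq0 tofrac_eq0 (negPf nz_c).
rewrite -(eq_map_poly (Dphi : phi \o _ =1 _)) map_poly_comp -Dr' map_polyZ /=.
by rewrite hornerZ (rootP ru0) mulr0.
Qed.

(** Subalgebras are handled as plain predicates because they arise from
    unions of chains, where no boolean membership test is at hand. *)
Record subalgebra (R : K -> Prop) : Prop := Subalgebra {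
  subalgebraC : forall c, R (iota c);
  subalgebraD : forall a b, R a -> R b -> R (a + b);
  subalgebraM : forall a b, R a -> R b -> R (a * b)
}.

Lemma subalgebraN R a : subalgebra R -> R a -> R (- a).
Proof.
move=> sR Ra; rewrite -mulN1r -(rmorph1 iota) -rmorphN.
by apply: (subalgebraM sR) => //; apply: (subalgebraC sR).
Qed.

Lemma subalgebraB R a b : subalgebra R -> R a -> R b -> R (a - b).
Proof. by move=> sR Ra Rb; apply: subalgebraD => //; apply: subalgebraN. Qed.

Lemma subalgebra1 R : subalgebra R -> R 1.
Proof. by move=> sR; rewrite -(rmorph1 iota); apply: subalgebraC. Qed.

Lemma subalgebra0 R : subalgebra R -> R 0.
Proof. by move=> sR; rewrite -(rmorph0 iota); apply: subalgebraC. Qed.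

Lemma subalgebraX R a n : subalgebra R -> R a -> R (a ^+ n).
Proof.
move=> sR Ra; elim: n => [|n IHn]; first exact: subalgebra1.
by rewrite exprS; apply: subalgebraM.
Qed.

Lemma subalgebra_horner R (p : {poly K}) a :
  subalgebra R -> (forall i, R p`_i) -> R a -> R p.[a].
Proof.
move=> sR Rp Ra; rewrite horner_coef.
elim/big_ind: _ => [|x y|i _]; [exact: subalgebra0 | exact: subalgebraD |].
by apply: subalgebraM => //; apply: subalgebraX.
Qed.

Lemma subalgebra_eval1 R (p : {poly k}) a : subalgebra R -> R a -> R (eval1 a p).
Proof.
move=> sR Ra; apply: subalgebra_horner => // i; rewrite coef_map.
exact: subalgebraC.
Qed.

(** A polynomial relation between [s] and [u], divided by the largest possible
    power of [s] and reduced modulo [s], leaves a nonzero relation on [u]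
    alone.  When [s] lies in the maximal ideal of a valuation ring containing
    [u], this says that the residue of [u] is algebraic over [k]; when [u] is a
    uniformizer, it bounds the power of [u] that divides [s]. *)
Lemma algebraic_relation_mod (s u : K) : s != 0 ->
  exists (p : {poly k}) (b : K),
    [/\ p != 0, forall R, subalgebra R -> R s -> R u -> R b
      & eval1 u p = s * b].
Proof.
move=> nz_s; have [alg_s|tr_s] := boolp.EM (algebraicOver iota s).
  have [a Ds] := algebraic_in_k alg_s.
  have nz_a : a != 0 by apply: contra nz_s; rewrite Ds => /eqP ->; rewrite rmorph0.
  exists 1, (iota a^-1); split; first exact: oner_neq0.
    by move=> R sR _ _; apply: subalgebraC.
  by rewrite rmorph1 Ds -rmorphM mulfV // rmorph1.
have [q nz_q] := algebraic_over_transcendental u tr_s.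
rewrite -(swapXYK q) eval_swapXY; move: nz_q; rewrite -swapXY_eq0.
elim/poly_ind: (swapXY q) => [|{}q c IHq]; first by rewrite eqxx.
have [-> |nz_c _] := eqVneq c 0.
  rewrite addr0 mulf_eq0 polyX_eq0 orbF rmorphM /= map_polyX hornerMX.
  by move=> nz_q /eqP; rewrite mulf_eq0 (negPf nz_s) orbF => /eqP /IHq; apply.
rewrite rmorphD rmorphM /= map_polyX map_polyC hornerMXaddC /= => q0.
exists c, (- (map_poly (eval1 u) q).[s]); split=> //.
  move=> R sR Rs Ru; apply: subalgebraN => //.
  apply: subalgebra_horner => // i; rewrite coef_map.
  exact: subalgebra_eval1.
by apply/eqP; rewrite mulrN mulrC -addr_eq0 addrC q0.
Qed.

End AlgebraicDependence.

(** * Maximal subalgebras are valuation rings *)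

Section MaximalSubalgebra.

Variables (k : closedFieldType) (K : fieldType) (iota : {rmorphism k -> K}).

(** Zorn's lemma, started at [k[s]]: it does not contain [s^-1], because a
    polynomial multiple of [s] equal to 1 would be a relation on [s]. *)
Lemma maximal_subalgebra (s : K) : ~ algebraicOver iota s ->
  exists R, [/\ subalgebra iota R, R s, ~ R s^-1 &
    forall R', subalgebra iota R' -> (forall a, R a -> R' a) -> ~ R' s^-1 ->
      forall a, R' a -> R a].
Proof.
move=> tr_s.
(* The empty set is allowed because it is the union of the empty chain. *)
pose P (A : classical_sets.set K) :=
  (exists a, A a) -> [/\ subalgebra iota A, A s & ~ A s^-1].
have chainP F : classical_sets.subset F P ->
    classical_sets.total_on F classical_sets.subset ->
  P (classical_sets.bigcup F id).
  move=> FP Ftot [a0 [A0 FA0 A0a0]].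
  have FP' A a : F A -> A a -> [/\ subalgebra iota A, A s & ~ A s^-1].
    by move=> FA Aa; apply: FP => //; exists a.
  have [sA0 A0s _] := FP' _ _ FA0 A0a0.
  have common a b A B : F A -> F B -> A a -> B b ->
      exists2 C, F C & C a /\ C b.
    move=> FA FB Aa Bb; case: (Ftot A B FA FB) => sub.
      by exists B => //; split=> //; apply: sub.
    by exists A => //; split=> //; apply: sub.
  split.
  - split.
    + by move=> c; exists A0 => //; apply: (subalgebraC sA0).
    + move=> a b [A FA Aa] [B FB Bb].
      have [C FC [Ca Cb]] := common _ _ _ _ FA FB Aa Bb.
      by exists C => //; have [sC _ _] := FP' _ _ FC Ca; apply: (subalgebraD sC).
    + move=> a b [A FA Aa] [B FB Bb].
      have [C FC [Ca Cb]] := common _ _ _ _ FA FB Aa Bb.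
      by exists C => //; have [sC _ _] := FP' _ _ FC Ca; apply: (subalgebraM sC).
  - by exists A0.
  - by move=> [A FA Az]; have [_ _ []] := FP' _ _ FA Az.
have [R [PR maxR]] := classical_sets.Zorn_bigcup chainP.
pose R0 a := exists p, a = eval1 iota s p.
have sR0 : subalgebra iota R0.
  split=> [c|a b [p ->] [q ->]|a b [p ->] [q ->]].
  - by exists c%:P; rewrite eval1C.
  - by exists (p + q); rewrite rmorphD.
  - by exists (p * q); rewrite rmorphM.
have R0s : R0 s by exists 'X; rewrite eval1E map_polyX hornerX.
have nz_s : s != 0.
  by apply/eqP=> s0; apply: tr_s; rewrite s0; apply: algebraic0.
have R0z : ~ R0 s^-1.
  case=> p Dp; have : eval1 iota s (p * 'X) = eval1 iota s 1.
    by rewrite rmorphM -Dp [X in _ * X]eval1E map_polyX hornerX mulVf // rmorph1.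
  move/(eval1_inj tr_s)/(congr1 (horner^~ 0)); rewrite hornerMX mulr0 hornerC.
  by move/eqP; rewrite eq_sym oner_eq0.
have [a Ra] : exists a, R a.
  apply: boolp.contrapT => noR; apply: (maxR R0); last by split.
  split; first by move=> a Ra; case: noR; exists a.
  by move=> sub; apply: noR; exists s; apply: sub.
have [sR Rs Rz] := PR (ex_intro _ a Ra); exists R; split=> // R' sR' RR' R'z b R'b.
apply: boolp.contrapT => nRb; apply: (maxR R').
  by split=> // sub; apply: nRb; apply: sub.
by split=> //; apply: RR'.
Qed.

Definition adjoin (R : K -> Prop) (y a : K) : Prop :=
  exists2 q : {poly K}, forall i, R q`_i & a = q.[y].

Lemma adjoin_subalgebra R y : subalgebra iota R -> subalgebra iota (adjoin R y).
Proof.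
move=> sR; split=> [c|a b [p Rp ->] [q Rq ->]|a b [p Rp ->] [q Rq ->]].
- exists (iota c)%:P; last by rewrite hornerC.
  move=> i; rewrite coefC; case: ifP => _; first exact: (subalgebraC sR).
  exact: (subalgebra0 sR).
- exists (p + q); last by rewrite hornerD.
  by move=> i; rewrite coefD; apply: (subalgebraD sR).
- exists (p * q); last by rewrite hornerM.
  move=> i; rewrite coefM.
  elim/big_ind: _ => [|u v|j _]; [exact: (subalgebra0 sR)|exact: (subalgebraD sR)|].
  exact: (subalgebraM sR).
Qed.

Lemma sub_adjoin R y : subalgebra iota R -> forall a, R a -> adjoin R y a.
Proof.
move=> sR a Ra; exists a%:P; last by rewrite hornerC.
by move=> i; rewrite coefC; case: ifP => _ //; apply: (subalgebra0 sR).
Qed.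

Lemma mem_adjoin R y : subalgebra iota R -> adjoin R y y.
Proof.
move=> sR; exists 'X; last by rewrite hornerX.
move=> i; rewrite coefX; case: eqP => _; first exact: (subalgebra1 sR).
exact: (subalgebra0 sR).
Qed.

Definition valuation_ring (V : K -> Prop) : Prop :=
  subalgebra iota V /\ forall a, V a \/ V a^-1.

Section Maximal.

Variables (s : K) (R : K -> Prop).
Hypotheses (sR : subalgebra iota R) (Rs : R s) (Rz : ~ R s^-1).
Hypothesis maxR : forall R', subalgebra iota R' -> (forall a, R a -> R' a) ->
  ~ R' s^-1 -> forall a, R' a -> R a.

Let nz_s : s != 0.
Proof. by apply/eqP=> s0; apply: Rz; rewrite s0 invr0 -s0. Qed.

Lemma maximal_adjoin y : ~ R y -> adjoin R y s^-1.
Proof.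
move=> nRy; apply: boolp.contrapT => nz; apply: nRy.
apply: (maxR (adjoin_subalgebra y sR)) => //; first exact: sub_adjoin.
exact: mem_adjoin.
Qed.

(** Inverting [1 + s a] cannot bring in [s^-1]: if [s^-1] is a polynomial in
    the inverse of [e = 1 + s a], then [s^-1 e^m] lies in [R] for some [m],
    and so does [s^-1] since [e^m] is congruent to 1 modulo [s R].  In other
    words, [s] belongs to the Jacobson radical of [R]. *)
Lemma maximal_unit a : R a -> 1 + s * a != 0 /\ R (1 + s * a)^-1.
Proof.
move=> Ra; set e := 1 + s * a.
have nz_e : e != 0.
  apply/eqP => e0; apply: Rz; suff -> : s^-1 = - a by apply: subalgebraN sR _.
  apply: (mulfI nz_s); rewrite mulfV // mulrN.
  by apply/eqP; rewrite -addr_eq0 -/e e0.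
have Re : R e.
  apply: (subalgebraD sR); first exact: (subalgebra1 sR).
  exact: (subalgebraM sR).
have eX m : exists2 b, R b & e ^+ m = 1 + s * b.
  elim: m => [|m [b Rb Db]].
    by exists 0; [exact: (subalgebra0 sR) | rewrite mulr0 addr0].
  exists (e * b + a); last by rewrite exprS Db /e; ring.
  by apply: (subalgebraD sR) => //; apply: (subalgebraM sR).
split=> //; apply: boolp.contrapT => /maximal_adjoin[q Rq Dz]; apply: Rz.
pose m := size q; have [b Rb Db] := eX m.
have Rze : R (s^-1 * e ^+ m).
  rewrite Dz horner_coef mulr_suml.
  elim/big_ind: _ => [|u v|j _]; [exact: (subalgebra0 sR)|exact: (subalgebraD sR)|].
  rewrite -mulrA; apply: (subalgebraM sR) => //.
  rewrite exprVn mulrC -expfB_cond; first exact: (subalgebraX _ sR).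
  by rewrite (negPf nz_e) add0n ltnW.
have -> : s^-1 = s^-1 * e ^+ m - b by rewrite Db mulrDr mulr1 mulKf // addrK.
exact: (subalgebraB sR).
Qed.

(** A relation of degree at most [m] that witnesses [s^-1] in [R[y]]. *)
Let reduced y m : Prop :=
  exists2 q : {poly K}, (forall i, R q`_i) & (size q <= m.+1)%N /\ s * q.[y] = 1.

Lemma reduced0 y : ~ reduced y 0.
Proof.
case=> q Rq [/size1_polyC ->]; rewrite hornerC => sq; apply: Rz.
by rewrite -[s^-1]mulr1 -sq mulKf.
Qed.

(** A relation [s q(y^-1) = 1] of degree [l.+1], with its constant term moved
    to the right and divided out as a unit, expresses [y ^+ m.+1] through lower
    powers of [y] as soon as [l <= m]; substituting this in the relation for
    [y] lowers its degree. *)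
Lemma reduced_step y m l : y != 0 ->
  reduced y m.+1 -> reduced y^-1 l.+1 -> (l <= m)%N -> reduced y m.
Proof.
move=> nz_y [q Rq [szq sqy]] [b Rb [szb sby]] le_lm.
have RN := subalgebraN sR; have RM := subalgebraM sR; have RD := subalgebraD sR.
have [nz_e Re] := maximal_unit (RN _ (Rb 0)); set e := 1 + _ in nz_e Re.
(* The relation for [y^-1] multiplied by [y ^+ m.+1] has its coefficients in
   reverse order; the constant one has been absorbed in the unit [e]. *)
pose r := \poly_(i < m.+1) (if (m - i <= l)%N then b`_(m - i).+1 / e else 0).
have Rr i : R r`_i.
  rewrite coef_poly; case: ifP => _; last exact: (subalgebra0 sR).
  by case: ifP => _; [apply: RM | exact: (subalgebra0 sR)].
have Dym : y ^+ m.+1 = s * r.[y].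
  have De : e = s * \sum_(i < l.+1) b`_i.+1 / y ^+ i.+1.
    rewrite /e mulrN; apply/eqP; rewrite subr_eq -[X in X == _]sby; apply/eqP.
    rewrite (horner_coef_wide _ szb) big_ord_recl expr0 mulr1 mulrDr addrC.
    by congr (_ * _ + _); apply: eq_bigr => i _; rewrite exprVn.
  apply: (mulIf nz_e); rewrite {1}De -!mulrA mulrCA; congr (_ * _).
  rewrite mulr_sumr horner_poly mulr_suml.
  rewrite [RHS](reindex_inj rev_ord_inj) /=.
  rewrite -(big_mkord xpredT (fun i => y ^+ m.+1 * (b`_i.+1 / y ^+ i.+1))).
  rewrite (big_nat_widen _ _ m.+1) // big_mkord [LHS]big_mkcond /=.
  apply: eq_bigr => i _; rewrite subSS subKn ?leq_ord // ltnS.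
  case: ifP => _; last by rewrite !mul0r.
  rewrite mulrAC divfK // mulrCA; congr (_ * _).
  by rewrite -expfB_cond ?subSS // (negPf nz_y) add0n ltn_ord.
exists (take_poly m.+1 q + (s * q`_m.+1) *: r).
  move=> i; rewrite coefD coefZ coef_take_poly.
  apply: RD; last by do 2!apply: (subalgebraM sR) => //.
  by case: ifP => // _; apply: (subalgebra0 sR).
split.
  rewrite (leq_trans (size_polyD _ _)) // geq_max size_take_poly.
  by rewrite (leq_trans (size_scale_leq _ _)) // size_poly.
rewrite -[RHS]sqy; congr (_ * _).
rewrite hornerD hornerZ mulrAC -Dym.
rewrite (horner_coef_wide _ (size_take_poly _ _)) (horner_coef_wide _ szq).
rewrite [RHS]big_ord_recr /= mulrC; congr (_ + _).
by apply: eq_bigr => i _; rewrite coef_take_poly ltn_ord.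
Qed.

(** If neither [y] nor [y^-1] were in [R], both adjunctions would contain
    [s^-1] by maximality, and [reduced_step] would lower the degrees of the two
    relations forever. *)
Lemma maximal_valuation_ring : valuation_ring R.
Proof.
split=> // y; apply: boolp.contrapT => /boolp.not_orP[nRy nRyV].
have nz_y : y != 0.
  by apply/eqP=> y0; apply: nRy; rewrite y0; apply: (subalgebra0 sR).
have red x : ~ R x -> exists m, reduced x m.
  move=> /maximal_adjoin[q Rq Dz]; exists (size q), q => //.
  by split=> //; rewrite -Dz mulfV.
have [m ym] := red _ nRy; have [l yl] := red _ nRyV.
have [N leN] := ubnP (m + l); elim: N m l leN ym yl => // N IHN [|m] [|l] leN.
- by move/reduced0.
- by move/reduced0.
- by move=> _ /reduced0.
move=> ym yl; have [le_lm | /ltnW le_ml] := leqP l m.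
  by apply: (IHN m l.+1) (reduced_step nz_y ym yl le_lm) yl; rewrite addSn in leN.
have nz_yV : y^-1 != 0 by rewrite invr_eq0.
have ymV : reduced y^-1^-1 m.+1 by rewrite invrK.
by apply: (IHN m.+1 l) ym (reduced_step nz_yV yl ymV le_ml); rewrite addnS in leN.
Qed.

End Maximal.

End MaximalSubalgebra.

(** * Places and closed points *)

Section Place.

Variables (k : closedFieldType) (K : fieldType) (iota : {rmorphism k -> K}).
Variable V : K -> Prop.
Hypothesis valV : valuation_ring iota V.

Let sV : subalgebra iota V := proj1 valV.

(** The nonunits of [V].  Zero is singled out because its inverse is 0 by
    convention. *)
Definition valuation_ideal (a : K) : Prop := V a /\ (a = 0 \/ ~ V a^-1).

Local Notation M := valuation_ideal.

Lemma valuation_ideal0 : M 0.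
Proof. by split; [exact: (subalgebra0 sV) | left]. Qed.

Lemma valuation_idealM a b : V a -> M b -> M (a * b).
Proof.
move=> Va [Vb Mb]; split; first exact: (subalgebraM sV).
have [->|nz_a] := eqVneq a 0; first by left; rewrite mul0r.
case: Mb => [->|nVb]; first by left; rewrite mulr0.
right=> Vab; apply: nVb.
have -> : b^-1 = a * (a * b)^-1 by rewrite invfM mulrA divff // mul1r.
exact: (subalgebraM sV).
Qed.

Lemma valuation_idealN a : M a -> M (- a).
Proof.
move=> Ma; rewrite -mulN1r -(rmorph1 iota) -rmorphN.
by apply: valuation_idealM => //; apply: (subalgebraC sV).
Qed.

Lemma valuation_idealD a b : M a -> M b -> M (a + b).
Proof.
wlog Vab : a b / V (a / b).
  move=> wl Ma Mb; have [_ /(_ (a / b))[]] := valV; first by move/wl; apply.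
  by rewrite invfM invrK mulrC addrC => /wl; apply.
move=> Ma Mb; have [b0|nz_b] := eqVneq b 0; first by rewrite b0 addr0.
have -> : a + b = (a / b + 1) * b by rewrite mulrDl divfK // mul1r.
apply: valuation_idealM Mb; apply: (subalgebraD sV) => //.
exact: (subalgebra1 sV).
Qed.

Lemma valuation_ideal1 : ~ M 1.
Proof.
case=> _ [/eqP|]; first by rewrite oner_eq0.
by rewrite invr1; apply; apply: (subalgebra1 sV).
Qed.

Lemma valuation_unit a : V a -> ~ M a -> a != 0 /\ V a^-1.
Proof.
move=> Va nMa; split.
  by apply/eqP=> a0; apply: nMa; rewrite a0; apply: valuation_ideal0.
by apply: boolp.contrapT => nV; apply: nMa; split=> //; right.
Qed.

Lemma valuation_ideal_prime a b : V a -> M (a * b) -> M a \/ M b.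
Proof.
move=> Va Mab; have [Ma|nMa] := boolp.EM (M a); first by left.
have [nz_a VaV] := valuation_unit Va nMa; right.
by rewrite -[b](mulKf nz_a); apply: valuation_idealM.
Qed.

Lemma valuation_idealC c : M (iota c) -> c = 0.
Proof.
move=> Mc; have [//|nz_c] := eqVneq c 0; case: valuation_ideal1.
rewrite -(mulVf (_ : iota c != 0)) ?fmorph_eq0 // -fmorphV.
by apply: valuation_idealM => //; apply: (subalgebraC sV).
Qed.

Section Residue.

Variables (s : K).
Hypotheses (trdeg1 : transcendence_degree_one iota) (nz_s : s != 0) (Ms : M s).

(** The residue field is [k]: by [algebraic_relation_mod] some nonzero
    polynomial over [k] takes at [u] a value in the maximal ideal; it splits
    into linear factors and the ideal is prime. *)
Lemma residue_exists u : V u -> exists c, M (u - iota c).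
Proof.
move=> Vu; have [p [b [nz_p Rb]]] := algebraic_relation_mod trdeg1 u nz_s.
have {}Vb : V b by apply: Rb; [exact: sV|case: Ms|].
rewrite eval1E; have [r Dp] := closed_field_poly_normal p.
move=> Dsb; have : M (map_poly iota p).[u].
  by rewrite Dsb mulrC; apply: valuation_idealM.
have lead_p : ~ M (iota (lead_coef p)).
  by move/valuation_idealC/eqP; rewrite lead_coef_eq0 (negPf nz_p).
rewrite Dp map_polyZ hornerZ => /valuation_ideal_prime[].
- exact: (subalgebraC sV).
- by move/lead_p.
elim: r {Dp} => [|c r IHr].
  by rewrite big_nil rmorph1 hornerC => /valuation_ideal1.
have Vuc : V (u - iota c) by apply: (subalgebraB sV) => //; apply: (subalgebraC sV).
rewrite big_cons rmorphM rmorphB /= map_polyX map_polyC hornerM hornerXsubC /=.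
by case/(valuation_ideal_prime Vuc) => [Mc|/IHr //]; exists c.
Qed.

End Residue.

Definition has_residue (u : K) (c : k) : Prop := M (u - iota c).

Lemma has_residueV u c : has_residue u c -> V u.
Proof.
case=> Vuc _; rewrite -(subrK (iota c) u); apply: (subalgebraD sV) => //.
exact: (subalgebraC sV).
Qed.

Lemma has_residueC c : has_residue (iota c) c.
Proof. by rewrite /has_residue subrr; apply: valuation_ideal0. Qed.

Lemma has_residueD u v c e :
  has_residue u c -> has_residue v e -> has_residue (u + v) (c + e).
Proof.
by rewrite /has_residue rmorphD opprD addrACA; apply: valuation_idealD.
Qed.

Lemma has_residueM u v c e :
  has_residue u c -> has_residue v e -> has_residue (u * v) (c * e).
Proof.
move=> uc ve; have Vu := has_residueV uc.
rewrite /has_residue.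
have -> : u * v - iota (c * e) = u * (v - iota e) + iota e * (u - iota c).
  by rewrite rmorphM; ring.
apply: valuation_idealD; apply: valuation_idealM => //.
exact: (subalgebraC sV).
Qed.

Lemma has_residue_mmap n (y : 'I_n -> K) (P : 'I_n -> k) F :
  (forall i, has_residue (y i) (P i)) -> has_residue (mmap iota y F) F.@[P].
Proof.
move=> yP; rewrite mevalE /mmap.
elim/big_rec2: _ => [|m u c _ uc].
  by rewrite -(rmorph0 iota); apply: has_residueC.
apply: has_residueD => //; apply: has_residueM; first exact: has_residueC.
rewrite /mmap1; elim/big_rec2: _ => [|i v e _ ve].
  by rewrite -(rmorph1 iota); apply: has_residueC.
apply: has_residueM => //.
elim: (m i) => [|l IHl].
  by rewrite !expr0 -(rmorph1 iota); apply: has_residueC.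
by rewrite !exprS; apply: has_residueM.
Qed.

Lemma has_residue_unit u c : has_residue u c -> c != 0 -> u != 0 /\ V u^-1.
Proof.
move=> uc nz_c; apply: valuation_unit (has_residueV uc) _ => Mu.
move/eqP: nz_c; apply; apply: valuation_idealC.
rewrite -(subKr u (iota c)); apply: valuation_idealD => //.
exact: valuation_idealN.
Qed.

(** A coordinate of least valuation normalizes the generic point so that all
    its coordinates lie in [V] and have residues. *)
Lemma valuation_min_ratio n (x : 'I_n -> K) : (exists i, x i != 0) ->
  exists2 j, x j != 0 & forall i, V (x i / x j).
Proof.
move=> nz_x.
suff [j nz_j Vj] : exists2 j, x j != 0 & forall i, i \in enum 'I_n -> V (x i / x j).
  by exists j => // i; apply: Vj; rewrite mem_enum.
have [i0 nz_i0] := nz_x; have V0 := subalgebra0 sV; have V1 := subalgebra1 sV.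
elim: (enum _) => [|i l [j nz_j Vj]]; first by exists i0.
have [_ /(_ (x i / x j))[Vij|]] := valV.
  by exists j => // i'; rewrite inE => /predU1P[->|/Vj].
have [xi0 _|nz_i] := eqVneq (x i) 0.
  exists j => // i'; rewrite inE => /predU1P[->|/Vj //].
  by rewrite xi0 mul0r.
rewrite invfM invrK mulrC => Vji; exists i => // i'.
rewrite inE => /predU1P[->|/Vj Vi'j]; first by rewrite divff.
by rewrite -(divfK nz_j (x i')) -(mulrA (_ / _));  apply: (subalgebraM sV).
Qed.

End Place.

Section HomogeneousEvaluation.

Variables (k K : fieldType) (iota : {rmorphism k -> K}) (n : nat).

Lemma mmap_homog_scale (x y : 'I_n -> K) (c : K) d (F : {mpoly k[n]}) :
  F \is d.-homog -> (forall i, x i = c * y i) ->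
  mmap iota x F = c ^+ d * mmap iota y F.
Proof.
move=> /dhomogP hF Dx; rewrite /mmap mulr_sumr; apply: eq_big_seq => m /hF <-.
rewrite mulrCA; congr (_ * _).
rewrite /mmap1 /= mdegE -prodrXr -big_split /=; apply: eq_bigr => i _.
by rewrite Dx exprMn.
Qed.

End HomogeneousEvaluation.

Section ClosedPoints.

Variables (k : closedFieldType) (K : fieldType) (iota : {rmorphism k -> K}).
Variables (n : nat) (x : 'I_n -> K).
Hypothesis trdeg1 : transcendence_degree_one iota.
Hypothesis nz_x : exists i, x i != 0.

(** The residues of the normalized generic point at a place where [z^-1]
    vanishes form a closed point [P].  The local ring at [P] is contained in
    the valuation ring, which does not contain [z]. *)
Lemma exists_pole (z : K) : ~ algebraicOver iota z ->
  exists2 P, closed_point iota x P & ~ in_local_ring iota x P z.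
Proof.
move=> tr_z.
have tr_s : ~ algebraicOver iota z^-1 by move/algebraic_inv; rewrite invrK.
have nz_s : z^-1 != 0 by apply/eqP=> s0; apply: tr_s; rewrite s0; apply: algebraic0.
have [V [sV Vs]] := maximal_subalgebra tr_s; rewrite invrK => nVz maxV.
have nVsV : ~ V z^-1^-1 by rewrite invrK.
have valV : valuation_ring iota V.
  apply: (maximal_valuation_ring sV Vs) => // R' sR' VR'.
  by rewrite invrK; apply: maxV.
have Ms : valuation_ideal V z^-1 by split=> //; right.
have [j nz_j Vj] := valuation_min_ratio valV nz_x.
have /boolp.choice[P yP] := fun i => residue_exists valV trdeg1 nz_s Ms (Vj i).
have Dx i : x i = x j * (x i / x j) by rewrite mulrC divfK.
have resF F := has_residue_mmap valV F yP.
exists P.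
  split.
    exists j; apply/eqP=> Pj; have := yP j; rewrite Pj rmorph0 subr0 divff //.
    exact: (valuation_ideal1 valV).
  move=> d F hF Fx0; apply: (valuation_idealC valV).
  have := resF F; rewrite /has_residue.
  have /eqP : (x j) ^+ d * mmap iota (fun i => x i / x j) F = 0.
    by rewrite -(mmap_homog_scale iota hF Dx).
  rewrite mulf_eq0 expf_eq0 (negPf nz_j) andbF /= => /eqP ->.
  by rewrite sub0r => /(valuation_idealN valV); rewrite opprK.
case=> d [F [H [hF hH HP Dz]]]; apply: nVz; rewrite Dz.
rewrite (mmap_homog_scale iota hF Dx) (mmap_homog_scale iota hH Dx).
rewrite -mulf_div divff ?expf_neq0 // mul1r; apply: (subalgebraM sV).
  exact: has_residueV (resF F).
by case: (has_residue_unit valV (resF H) HP).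
Qed.

Lemma exists_closed_point : exists P, closed_point iota x P.
Proof. by have [t [tr_t _]] := trdeg1; have [P] := exists_pole tr_t; exists P. Qed.

Lemma regular_everywhere_constant z :
  (forall P, closed_point iota x P -> in_local_ring iota x P z) ->
  exists c, z = iota c.
Proof.
move=> reg_z; apply: algebraic_in_k; apply: boolp.contrapT => tr_z.
by have [P clP] := exists_pole tr_z; apply; apply: reg_z.
Qed.

End ClosedPoints.

(** * Local rings and derivations *)

Section IndependentGenerators.

Variables (K : fieldType) (M : lmodType K).

(** A spanning family of least size is independent, since in a dependent one
    some member is a combination of the others and can be dropped. *)
Lemma independent_generators m (v : 'I_m -> M) :
  exists r (u : 'I_r -> M) (C : 'I_m -> 'I_r -> K),
    (forall i, v i = \sum_l C i l *: u l) /\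
    (forall c : 'I_r -> K, \sum_l c l *: u l = 0 -> forall l, c l = 0).
Proof.
have reduce r : (exists (u : 'I_r -> M) (C : 'I_m -> 'I_r -> K),
    forall i, v i = \sum_l C i l *: u l) ->
  exists r (u : 'I_r -> M) (C : 'I_m -> 'I_r -> K),
    (forall i, v i = \sum_l C i l *: u l) /\
    (forall c : 'I_r -> K, \sum_l c l *: u l = 0 -> forall l, c l = 0).
  elim: r => [|r IHr] [u [C Dv]]; first by exists 0, u, C; split=> // c _ [].
  have [free_u|] := boolp.EM (forall c : 'I_r.+1 -> K,
      \sum_l c l *: u l = 0 -> forall l, c l = 0); first by exists r.+1, u, C.
  move=> /boolp.existsNP[c] /boolp.not_implyP[c0] /boolp.existsNP[l0] /eqP nz_c.
  apply: IHr; exists (fun l => u (lift l0 l)).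
  exists (fun i l => C i (lift l0 l) - C i l0 * (c l0)^-1 * c (lift l0 l)) => i.
  have Du : u l0 = - \sum_l ((c l0)^-1 * c (lift l0 l)) *: u (lift l0 l).
    move: c0; rewrite (bigD1_ord l0) //= => /eqP; rewrite addr_eq0 => /eqP Dc.
    apply: (scalerI nz_c); rewrite Dc scalerN; congr (- _).
    by rewrite scaler_sumr; apply: eq_bigr => l _; rewrite scalerA mulVKf.
  rewrite Dv (bigD1_ord l0) //= Du scalerN scaler_sumr addrC -sumrB.
  by apply: eq_bigr => l _; rewrite scalerBl scalerA mulrA.
apply: (reduce m); exists v, (fun i l => (i == l)%:R) => i.
rewrite (bigD1 i) //= eqxx scale1r big1 ?addr0 // => l /negPf.
by rewrite eq_sym => ->; rewrite scale0r.
Qed.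

End IndependentGenerators.

Section DerivationRules.

Variables (k : closedFieldType) (K : fieldType) (iota : {rmorphism k -> K}).
Variables (M : lmodType K) (E : K -> M) (dE : derivation iota E).

Lemma derivationV a : a != 0 -> E a^-1 = - (a^-1 ^+ 2 *: E a).
Proof.
case: dE => ED EM EC nz_a; have := EC 1; rewrite rmorph1 -(mulfV nz_a) EM.
move/eqP; rewrite addr_eq0 => /eqP Da; apply: (scalerI nz_a); rewrite Da scalerN.
by rewrite scalerA expr2 mulVKf.
Qed.

End DerivationRules.

Section LocalRing.

Variables (k : closedFieldType) (K : fieldType) (iota : {rmorphism k -> K}).
Variables (n : nat) (x : 'I_n -> K) (P : 'I_n -> k).
Hypothesis clP : closed_point iota x P.

Local Notation O := (in_local_ring iota x P).
Local Notation m := (in_max_ideal iota x P).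

Lemma closed_point_neq0 d (H : {mpoly k[n]}) :
  H \is d.-homog -> H.@[P] != 0 -> mmap iota x H != 0.
Proof. by move=> hH; apply: contra => /eqP/(proj2 clP d H hH) ->. Qed.

Lemma dhomogC (c : k) : (c%:MP : {mpoly k[n]}) \is 0.-homog.
Proof. by rewrite -[c]mulr1 mpolyCM mul_mpolyC dhomogZ ?dhomog1. Qed.

Lemma dhomogXi (i : 'I_n) : ('X_i : {mpoly k[n]}) \is 1.-homog.
Proof. by rewrite dhomogX /= mdeg1. Qed.

Lemma dhomogXn (i : 'I_n) d : ('X_i ^+ d : {mpoly k[n]}) \is d.-homog.
Proof. by have := dhomogMn d (dhomogXi i); rewrite mul1n. Qed.

Lemma local_ring_subalgebra : subalgebra iota O.
Proof.
split=> [c|a b|a b].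
- exists 0, c%:MP, 1; rewrite dhomogC dhomog1 meval1 oner_neq0.
  by rewrite mmapC rmorph1 divr1.
- move=> [d [F [H [hF hH HP ->]]]] [e [F' [H' [hF' hH' H'P ->]]]].
  exists (d + e)%N, (F * H' + F' * H), (H * H').
  have hFH : F * H' + F' * H \is (d + e)%N.-homog.
    by apply: dhomogD; last rewrite addnC; apply: dhomogM.
  rewrite mevalM mulf_neq0 // dhomogM // hFH.
  split=> //; rewrite addf_div ?(closed_point_neq0 hH) ?(closed_point_neq0 hH') //.
  by rewrite rmorphD !rmorphM.
- move=> [d [F [H [hF hH HP ->]]]] [e [F' [H' [hF' hH' H'P ->]]]].
  exists (d + e)%N, (F * F'), (H * H').
  by rewrite mevalM mulf_neq0 // !dhomogM // mulf_div !rmorphM.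
Qed.

Let sO := local_ring_subalgebra.

Lemma max_idealMr a b : O a -> m b -> m (a * b).
Proof.
move=> [d [F [H [hF hH HP ->]]]] [e [F' [H' [hF' hH' H'P F'P ->]]]].
exists (d + e)%N, (F * F'), (H * H').
by rewrite !mevalM F'P mulr0 mulf_neq0 // !dhomogM // mulf_div !rmorphM.
Qed.

Lemma max_ideal_local a : m a -> O a.
Proof. by case=> d [F [H [hF hH HP _ ->]]]; exists d, F, H. Qed.

Lemma max_idealC c : m (iota c) -> c = 0.
Proof.
case=> d [F [H [hF hH HP FP Dc]]].
have : (F - c *: H).@[P] = 0.
  apply: (proj2 clP d); first by rewrite rpredB ?rpredZ.
  by rewrite rmorphB /= mmapZ Dc divfK ?subrr // (closed_point_neq0 hH).
rewrite mevalB mevalZ FP sub0r => /eqP; rewrite oppr_eq0 mulf_eq0 (negPf HP).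
by rewrite orbF => /eqP.
Qed.

Lemma local_ring_value z : O z -> exists c, m (z - iota c).
Proof.
case=> d [F [H [hF hH HP ->]]]; exists (F.@[P] / H.@[P]).
exists d, (F - (F.@[P] / H.@[P]) *: H), H; split=> //.
- by rewrite rpredB ?rpredZ.
- by rewrite mevalB mevalZ divfK // subrr.
- by rewrite rmorphB /= mmapZ mulrBl mulfK // (closed_point_neq0 hH).
Qed.

Lemma coordinate_ratio_local i j : P j != 0 -> O (x i / x j).
Proof.
move=> Pj; exists 1%N, 'X_i, 'X_j; rewrite !dhomogXi mevalXU.
by rewrite !mmapX !mmap1U.
Qed.

Lemma coordinate_neq0 j : P j != 0 -> x j != 0.
Proof.
move=> Pj; have := closed_point_neq0 (dhomogXi j).
by rewrite mevalXU mmapX mmap1U; apply.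
Qed.

Lemma local_ring_fractions : is_function_field iota x ->
  forall z, exists a b, [/\ O a, O b, b != 0 & z = a / b].
Proof.
case=> _ ffx z; have [d [F [H [hF hH nz_H ->]]]] := ffx z.
have [[j Pj] _] := clP; have nz_j := coordinate_neq0 Pj.
have XP : ('X_j ^+ d).@[P] != 0 by rewrite rmorphXn /= mevalXU expf_neq0.
have nzX : mmap iota x ('X_j ^+ d) != 0.
  exact: closed_point_neq0 (dhomogXn j d) XP.
exists (mmap iota x F / mmap iota x ('X_j ^+ d)).
exists (mmap iota x H / mmap iota x ('X_j ^+ d)); split.
- by exists d, F, ('X_j ^+ d); rewrite dhomogXn.
- by exists d, H, ('X_j ^+ d); rewrite dhomogXn.
- by rewrite mulf_neq0 ?invr_eq0.
- by rewrite -mulf_div divff ?mulr1 // invr_eq0.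
Qed.

Section Derivations.

Variables (M : lmodType K) (E : K -> M) (dE : derivation iota E).

(** The quotient rule: elements of the local ring are rational functions of
    the affine coordinates [x i / x j], so the values of a derivation on the
    local ring [O] lie in the [O]-module generated by its values at these
    coordinates.  Finite generation is what allows a limit argument in powers
    of a uniformizer. *)
Lemma derivation_lattice j z : P j != 0 -> O z ->
  exists2 a : 'I_n -> K, forall i, O (a i) & E z = \sum_i a i *: E (x i / x j).
Proof.
move=> Pj; have [ED EM EC] := dE; have nz_j := coordinate_neq0 Pj.
pose L u := exists2 a : 'I_n -> K, forall i, O (a i) &
  u = \sum_i a i *: E (x i / x j).
have LD u v : L u -> L v -> L (u + v).
  move=> [a Oa ->] [b Ob ->]; exists (fun i => a i + b i).
    by move=> i; apply: (subalgebraD sO).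
  by rewrite -big_split; apply: eq_bigr => i _; rewrite scalerDl.
have LZ c u : O c -> L u -> L (c *: u).
  move=> Oc [a Oa ->]; exists (fun i => c * a i).
    by move=> i; apply: (subalgebraM sO).
  by rewrite scaler_sumr; apply: eq_bigr => i _; rewrite scalerA.
have L0 : L 0.
  exists (fun=> 0); first by move=> i; apply: (subalgebra0 sO).
  by rewrite big1 // => i _; rewrite scale0r.
pose A a := O a /\ L (E a).
have sA : subalgebra iota A.
  split=> [c|a b [Oa La] [Ob Lb]|a b [Oa La] [Ob Lb]].
  - by split; [exact: (subalgebraC sO)|rewrite EC].
  - by split; [exact: (subalgebraD sO)|rewrite ED; apply: LD].
  - split; first exact: (subalgebraM sO).
    by rewrite EM; apply: LD; apply: LZ.
have Ax i : A (x i / x j).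
  split; first exact: coordinate_ratio_local.
  exists (fun l => (i == l)%:R) => [l|].
    by case: eqP => _; [exact: (subalgebra1 sO)|exact: (subalgebra0 sO)].
  rewrite (bigD1 i) //= eqxx scale1r big1 ?addr0 // => l /negPf.
  by rewrite eq_sym => ->; rewrite scale0r.
have AF F : A (mmap iota (fun i => x i / x j) F).
  rewrite /mmap; elim/big_ind: _ => [|u v|e _].
  - exact: (subalgebra0 sA).
  - exact: (subalgebraD sA).
  - apply: (subalgebraM sA); first exact: (subalgebraC sA).
    rewrite /mmap1; elim/big_ind: _ => [|u v|i _].
    + exact: (subalgebra1 sA).
    + exact: (subalgebraM sA).
    + exact: (subalgebraX _ sA).
case=> d [F [H [hF hH HP Dz]]].
have Dx i : x i = x j * (x i / x j) by rewrite mulrC divfK.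
have nz_H := closed_point_neq0 hH HP.
have Oinv : O (mmap iota (fun i => x i / x j) H)^-1.
  exists d, ('X_j ^+ d), H; split; rewrite ?dhomogXn //.
  rewrite (mmap_homog_scale iota hH Dx) rmorphXn /= mmapX mmap1U.
  by rewrite invfM mulrA divff ?mul1r // expf_neq0.
move: nz_H; rewrite Dz (mmap_homog_scale iota hF Dx) (mmap_homog_scale iota hH Dx).
rewrite -mulf_div divff ?expf_neq0 // mul1r mulf_eq0 => /norP[_ nz_H].
rewrite EM (derivationV dE) // scalerN -scaleNr scalerA.
have [[OF LF] [OH LH]] := (AF F, AF H).
apply: LD; apply: LZ => //; rewrite mulNr; apply: (subalgebraN sO).
by apply: (subalgebraM sO) => //; apply: (subalgebraX _ sO).
Qed.

End Derivations.

Section Uniformizer.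

Hypothesis trdeg1 : transcendence_degree_one iota.
Variables (t : K).
Hypotheses (mt : m t) (genm : forall z, m z -> exists2 a, O a & z = a * t).

(** A nonzero [z] satisfies, together with [t], a relation [p(t) = z b] with
    [p] nonzero and [b] in the local ring.  If [N] is the order of [p] at 0,
    the cofactor of [t^N] in [p(t)] has a nonzero value at the point, so
    [z b] and a fortiori [z] cannot be divisible by [t^N.+1]. *)
Lemma krull_intersection z :
  (forall N, exists2 a, O a & z = a * t ^+ N) -> z = 0.
Proof.
move=> div_z; have [//|nz_z] := eqVneq z 0.
have nz_t : t != 0.
  apply: contra nz_z => /eqP t0; have [a _ ->] := div_z 1%N.
  by rewrite t0 mulr0.
have [p [b [nz_p Rb Dp]]] := algebraic_relation_mod trdeg1 t nz_z.
have Ot := max_ideal_local mt.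
have Oz : O z by have [a Oa ->] := div_z 0; rewrite mulr1.
have Ob := Rb _ sO Oz Ot.
have [N [q]] := multiplicity_XsubC p 0; rewrite nz_p /= => nrq Dq.
have [a Oa Dz] := div_z N.+1.
have Dqt : eval1 iota t q = b * a * t.
  apply: (mulIf (expf_neq0 N nz_t));
  have -> : b * a * t * t ^+ N = z * b by rewrite Dz exprS; ring.
  rewrite -Dp Dq rmorphM rmorphXn subr0; congr (_ * _ ^+ _).
  by rewrite eval1E map_polyX hornerX.
suff : m (iota q.[0]) by move/max_idealC/eqP; rewrite -rootE (negPf nrq).
have [r Dr] : exists r, q = r * 'X + q.[0]%:P.
  have /factor_theorem[r] : root (q - q.[0]%:P) 0.
    by rewrite rootE hornerD hornerN hornerC subrr.
  by rewrite subr0 => /(canRL (subrK _)); exists r.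
have -> : iota q.[0] = (b * a - eval1 iota t r) * t.
  rewrite mulrBl -Dqt {2}Dr rmorphD rmorphM eval1C.
  by rewrite [X in _ * X]eval1E map_polyX hornerX addrAC subrr add0r.
apply: max_idealMr => //; apply: (subalgebraB sO).
  exact: (subalgebraM sO).
exact: (subalgebra_eval1 _ sO).
Qed.

Lemma common_denominator (l : seq K) : is_function_field iota x ->
  exists2 b, b != 0 & O b /\ forall z, z \in l -> O (b * z).
Proof.
move=> ffx; elim: l => [|z l [b nz_b [Ob Obl]]].
  by exists 1; [exact: oner_neq0 | split=> //; apply: (subalgebra1 sO)].
have [a [c [Oa Oc nz_c Dz]]] := local_ring_fractions ffx z.
exists (c * b); first by rewrite mulf_neq0.
split=> [|y]; first exact: (subalgebraM sO).
rewrite inE => /predU1P[->|/Obl Oby]; last first.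
  by rewrite -mulrA; apply: (subalgebraM sO).
have -> : c * b * z = b * a by rewrite Dz mulrAC mulrCA divff // mulr1 mulrC.
exact: (subalgebraM sO).
Qed.

(** Write [z = c + a t] with [c] constant: as [E] kills [c] and [t], this gives
    [E z = t *: E a].  Iterating, [E z] is divisible by every power of [t]
    inside the finitely generated module of [derivation_lattice].  After
    clearing denominators this module embeds in a free one, where the claim
    follows from [krull_intersection] coordinate by coordinate. *)
Lemma derivation_zero_at_uniformizer (M : lmodType K) (E : K -> M) :
  is_function_field iota x -> derivation iota E -> E t = 0 -> forall z, E z = 0.
Proof.
move=> ffx dE Et0; have [ED EM EC] := dE.
suff E0 z : O z -> E z = 0.
  move=> z; have [a [b [Oa Ob nz_b ->]]] := local_ring_fractions ffx z.
  by rewrite EM (derivationV dE) // !E0 // !(scaler0, oppr0) addr0.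
move=> Oz; have [[j Pj] _] := clP.
have Etn N : exists2 a, O a & E z = t ^+ N *: E a.
  elim: N => [|N [a Oa ->]]; first by exists z; rewrite ?scale1r.
  have [c /genm[b Ob Da]] := local_ring_value Oa; exists b => //.
  have -> : a = b * t + iota c by rewrite -Da subrK.
  by rewrite ED EC addr0 EM Et0 scaler0 add0r scalerA -exprSr.
have [r [u [C [Dv free_u]]]] := independent_generators (fun i => E (x i / x j)).
have [b nz_b [Ob ObC]] :=
  common_denominator [seq C i l | i <- enum 'I_n, l <- enum 'I_r] ffx.
have {}ObC i l : O (b * C i l).
  by apply: ObC; apply/allpairsP; exists (i, l); rewrite !mem_enum.
have coordE N : exists2 beta : 'I_r -> K,
      forall l, exists2 a, O a & beta l = a * t ^+ N
    & b *: E z = \sum_l beta l *: u l.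
  have [a Oa ->] := Etn N; have [e Oe ->] := derivation_lattice dE Pj Oa.
  exists (fun l => (\sum_i e i * (b * C i l)) * t ^+ N).
    move=> l; exists (\sum_i e i * (b * C i l)) => //.
    elim/big_ind: _ => [|? ?|i _].
    - exact: (subalgebra0 sO).
    - exact: (subalgebraD sO).
    - exact: (subalgebraM sO).
  rewrite scalerA scaler_sumr.
  under eq_bigr => i _ do rewrite Dv scaler_sumr scaler_sumr.
  rewrite exchange_big /=; apply: eq_bigr => l _.
  rewrite mulr_suml scaler_suml; apply: eq_bigr => i _; rewrite !scalerA.
  by congr (_ *: _); ring.
have [beta _ Dbeta] := coordE 0.
suff beta0 l : beta l = 0.
  apply: (scalerI nz_b); rewrite Dbeta scaler0 big1 // => l _.
  by rewrite beta0 scale0r.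
apply: krull_intersection => N; have [gam div_gam Dgam] := coordE N.
have [a Oa Dga] := div_gam l; exists a => //; rewrite -Dga.
apply/eqP; rewrite -subr_eq0; apply/eqP.
apply: (free_u (fun l => beta l - gam l)).
under eq_bigr => l' _ do rewrite scalerBl.
by rewrite sumrB -Dbeta -Dgam subrr.
Qed.

End Uniformizer.

End LocalRing.

(** * Quadratic forms and linear vector fields *)

Section QuadraticForms.

Variables (k : closedFieldType) (g : nat).
Local Notation S := {mpoly k[g]}.
Implicit Types (A B M N : 'M[k]_g) (F H : S).

Definition linear_form B (i : 'I_g) : S := \sum_j B i j *: 'X_j.

(** Both sides are the matrix product [(M X)^T A (N X)], where [X] is the
    column of the variables. *)
Lemma sum_linear_forms A M N :
  \sum_i \sum_j A i j *: (linear_form M i * linear_form N j) =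
    quad (M^T *m A *m N).
Proof.
pose X : 'cV[S]_g := \col_i 'X_i; pose C M' := map_mx (@mpolyC g k) M' : 'M[S]_g.
have form_mx M' i : linear_form M' i = (C M' *m X) i 0.
  by rewrite mxE; apply: eq_bigr => j _; rewrite !mxE mul_mpolyC.
have sum_mx A' (L L' : 'cV[S]_g) :
    \sum_i \sum_j A' i j *: (L i 0 * L' j 0) = (L^T *m C A' *m L') 0 0.
  rewrite mxE exchange_big; apply: eq_bigr => j _; rewrite mxE mulr_suml.
  by apply: eq_bigr => i _; rewrite !mxE -mul_mpolyC mulrCA mulrA.
under eq_bigr => i _ do under eq_bigr => j _ do rewrite !form_mx.
have CT : (C M)^T = C M^T by apply/matrixP => i j; rewrite !mxE.
have CM A' B' : C A' *m C B' = C (A' *m B') by rewrite /C map_mxM.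
rewrite sum_mx trmx_mul CT !mulmxA -(mulmxA _ (C _) (C _)) CM.
rewrite -(mulmxA _ (C _) (C _)) CM mulmxA -sum_mx /quad.
by apply: eq_bigr => i _; apply: eq_bigr => j _; rewrite !mxE.
Qed.

Lemma linear_form1 i : linear_form 1%:M i = 'X_i.
Proof.
rewrite /linear_form (bigD1 i) //= mxE eqxx scale1r big1 ?addr0 // => j /negPf.
by rewrite mxE eq_sym => ->; rewrite scale0r.
Qed.

Lemma quadD A B : quad (A + B) = quad A + quad B.
Proof.
rewrite /quad -big_split; apply: eq_bigr => i _; rewrite -big_split.
by apply: eq_bigr => j _; rewrite mxE scalerDl.
Qed.

Lemma quadZ c A : quad (c *: A) = c *: quad A.
Proof.
rewrite /quad scaler_sumr; apply: eq_bigr => i _; rewrite scaler_sumr.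
by apply: eq_bigr => j _; rewrite mxE scalerA.
Qed.

Lemma quadB A B : quad (A - B) = quad A - quad B.
Proof. by rewrite quadD -scaleN1r quadZ scaleN1r. Qed.

Lemma quad_homog A : quad A \is 2.-homog.
Proof.
apply: rpred_sum => i _; apply: rpred_sum => j _; apply: rpredZ.
by apply: (dhomogM (d := 1) (e := 1)); apply: dhomogXi.
Qed.

Lemma subst_lin_quad M A : subst_lin M (quad A) = quad (M^T *m A *m M).
Proof.
rewrite -sum_linear_forms /subst_lin /quad raddf_sum; apply: eq_bigr => i _.
rewrite raddf_sum; apply: eq_bigr => j _.
rewrite /= comp_mpolyZ rmorphM /= !comp_mpolyXU -!tnth_nth !tnth_mktuple.
by [].
Qed.

(** The derivation of [S] that sends the column of variables [X] to [B X]: the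
    linear vector field of [B] on projective space. *)
Definition vector_field B F : S := \sum_i linear_form B i * F^`M(i).

Lemma vector_fieldD B F H :
  vector_field B (F + H) = vector_field B F + vector_field B H.
Proof.
rewrite /vector_field -big_split; apply: eq_bigr => i _.
by rewrite mderivD mulrDr.
Qed.

Lemma vector_fieldM B F H :
  vector_field B (F * H) = vector_field B F * H + F * vector_field B H.
Proof.
rewrite /vector_field mulr_suml mulr_sumr -big_split; apply: eq_bigr => i _.
by rewrite mderivM /=; ring.
Qed.

Lemma vector_fieldC B c : vector_field B c%:MP = 0.
Proof. by rewrite /vector_field big1 // => i _; rewrite mderivC mulr0. Qed.

Lemma vector_field0 B : vector_field B 0 = 0.
Proof. by rewrite -[0 in LHS]mpolyC0 vector_fieldC. Qed.

Lemma vector_fieldZ B c F : vector_field B (c *: F) = c *: vector_field B F.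
Proof. by rewrite -!mul_mpolyC vector_fieldM vector_fieldC mul0r add0r. Qed.

Lemma vector_fieldB B F H :
  vector_field B (F - H) = vector_field B F - vector_field B H.
Proof. by rewrite vector_fieldD -scaleN1r vector_fieldZ scaleN1r. Qed.

Lemma vector_field_sum B (I : Type) (r : seq I) (f : I -> S) :
  vector_field B (\sum_(i <- r) f i) = \sum_(i <- r) vector_field B (f i).
Proof.
elim: r => [|i r IHr]; first by rewrite !big_nil vector_field0.
by rewrite !big_cons vector_fieldD IHr.
Qed.

Lemma vector_fieldX B i : vector_field B 'X_i = linear_form B i.
Proof.
rewrite /vector_field (bigD1 i) //= big1 => [|j ne_ji]; rewrite mderivX mnm1E.
  by rewrite eqxx scale1r -{1}(add0m U_(i)%MM) addmK mpolyX0 mulr1 addr0.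
by rewrite eq_sym (negPf ne_ji) scale0r mulr0.
Qed.

Lemma linear_form_homog B i : linear_form B i \is 1.-homog.
Proof. by apply: rpred_sum => j _; apply: rpredZ; apply: dhomogXi. Qed.

Lemma vector_field_homog B d F : F \is d.-homog -> vector_field B F \is d.-homog.
Proof.
move=> /dhomogP hF; rewrite (mpolyE F) vector_field_sum.
rewrite big_seq; apply: rpred_sum => m /hF Dd; have {hF} <- : mdeg m = d := Dd.
rewrite vector_fieldZ; apply: rpredZ; apply: rpred_sum => i _.
rewrite mderivX -scalerAr; have [->|m_gt0] := posnP (m i).
  by rewrite scale0r rpred0.
apply: rpredZ; have le_im : (U_(i) <= m)%MM by rewrite lep1mP -lt0n.
have -> : mdeg m = (1 + mdeg (m - U_(i))%MM)%N.
  by rewrite -{1}(submK le_im) mdegD mdeg1 addnC.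
by apply: dhomogM; rewrite ?linear_form_homog // dhomogX.
Qed.

Lemma vector_field_quad B A : vector_field B (quad A) = quad (A *m B + B^T *m A).
Proof.
rewrite quadD -[A in quad (A *m B)]mul1mx -[B^T *m A]mulmx1 -trmx1.
rewrite -!sum_linear_forms /quad vector_field_sum -big_split.
apply: eq_bigr => i _; rewrite vector_field_sum -big_split; apply: eq_bigr => j _.
rewrite vector_fieldZ vector_fieldM !vector_fieldX /= trmx1 !linear_form1.
by rewrite -scalerDr addrC.
Qed.

End QuadraticForms.

(** * Curves without global vector fields *)

Section FunctionField.

Variables (k : closedFieldType) (K : fieldType) (iota : {rmorphism k -> K}).
Variables (n g : nat) (x : 'I_n -> K) (w : 'I_g -> K).

(** Every element of [K] is a quotient of elements of one local ring of [X],
    and this ring is also a local ring for the coordinates [w]. *)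
Lemma closed_embedding_function_field :
  transcendence_degree_one iota -> is_function_field iota x ->
  closed_embedding iota x w -> is_function_field iota w.
Proof.
move=> trdeg1 ffx [xw _].
have [P clP] := exists_closed_point trdeg1 (proj1 ffx).
have [Q clQ eqPQ] := xw P clP; have [[j Qj] _] := clQ.
split; first by exists j; apply: (coordinate_neq0 clQ).
move=> z; have [a [b [/eqPQ Oa /eqPQ Ob nz_b ->]]] := local_ring_fractions clP ffx z.
have [d [F [H [hF hH HQ Da]]]] := Oa; have [e [F' [H' [hF' hH' H'Q Db]]]] := Ob.
have nz_H := closed_point_neq0 clQ hH HQ.
have nz_F' : mmap iota w F' != 0.
  by apply: contra nz_b; rewrite Db => /eqP ->; rewrite mul0r.
exists (d + e)%N, (F * H'), (H * F'); rewrite !dhomogM // !rmorphM mulf_neq0 //.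
by rewrite Da Db invf_div mulf_div.
Qed.

End FunctionField.

Section NoVectorFields.

Variables (k : closedFieldType) (K : fieldType) (iota : {rmorphism k -> K}).
Variables (n : nat) (x : 'I_n -> K) (hX : nonsingular_projective_curve iota x).
Variables (Omega : lmodType K) (d : K -> Omega).
Hypothesis hOmega : kaehler_differentials iota d.
Variables (g : nat) (omega : 'I_g -> Omega).
Hypothesis homega : regular_differentials_basis iota d x omega.
Variable w : 'I_g -> K.
Hypothesis hw : canonical_coordinates omega w.

Lemma canonical_coordinates_free (c : 'I_g -> k) :
  \sum_i iota (c i) * w i = 0 -> forall i, c i = 0.
Proof.
case: hw => eta _ Domega cw0; have [_ free_omega _] := homega.
apply: free_omega; under eq_bigr => i _ do rewrite Domega scalerA.
by rewrite -scaler_suml cw0 scale0r.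
Qed.

Lemma canonical_coordinates_neq0 i : w i != 0.
Proof.
apply/eqP=> wi0.
have := @canonical_coordinates_free (fun l => (l == i)%:R).
rewrite (bigD1 i) //= wi0 mulr0 add0r big1 => [/(_ erefl i)/eqP|j /negPf ->].
  by rewrite eqxx oner_eq0.
by rewrite rmorph0 mul0r.
Qed.

(** Let [h] be the contraction with [D].  Each [h (omega i)] is regular
    everywhere, hence constant, and equals [w i * h eta].  If [h eta] were not
    0, two of the [w i] would be linearly dependent over [k]; so [h eta = 0].
    At a uniformizer [t], the derivation [D t *: d - D *: d t] vanishes by
    [derivation_zero_at_uniformizer].  If [D t] is not 0, it follows that
    [D t *: omega i = h (omega i) *: d t = 0], which is absurd; and if [D t] is
    0, the same lemma gives [D = 0]. *)
Lemma no_global_vector_field (D : K -> K^o) : (1 < g)%N -> derivation iota D ->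
  (forall P z, closed_point iota x P ->
     in_local_ring iota x P z -> in_local_ring iota x P (D z)) ->
  forall z, D z = 0.
Proof.
move=> g_gt1 dD regD; have [ffx trdeg1 nonsing] := hX.
have [dd univ] := hOmega; have [h Dh _] := univ _ D dD.
have [reg_omega _ _] := homega; have [eta nz_eta Domega] := hw.
have const i : exists c, h (omega i) = iota c.
  apply: (regular_everywhere_constant trdeg1 (proj1 ffx)) => P clP.
  have [m [a [b [Oa Ob ->]]]] := reg_omega i P clP.
  have sO := local_ring_subalgebra clP.
  rewrite linear_sum; elim/big_ind: _ => [|u v|j _].
  - exact: (subalgebra0 sO).
  - exact: (subalgebraD sO).
  - by rewrite linearZ /= -Dh; apply: (subalgebraM sO) => //; apply: regD.
have /boolp.choice[c Dc] := const.
have h_omega i : h (omega i) = w i * h eta by rewrite Domega linearZ.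
pose i0 := Ordinal (ltnW g_gt1); pose i1 := Ordinal g_gt1.
have ne01 : i1 != i0 by [].
have h_eta : h eta = 0.
  have [//|nz_h] := eqVneq (h eta) 0.
  (* The relation [c i1 * w i0 - c i0 * w i1 = 0]. *)
  pose e l := if l == i0 then c i1 else if l == i1 then - c i0 else 0.
  have /canonical_coordinates_free/(_ i0) : \sum_l iota (e l) * w l = 0.
    rewrite (bigD1 i0) //= (bigD1 i1) //= big1 => [|l /andP[/negPf l0 /negPf l1]].
      rewrite /e eqxx (negPf ne01) eqxx addr0 rmorphN -!Dc !h_omega.
      by rewrite mulNr; apply/eqP; rewrite subr_eq0; apply/eqP; ring.
    by rewrite /e l0 l1 rmorph0 mul0r.
  rewrite /e eqxx => c10; have := Dc i1; rewrite c10 rmorph0 h_omega => /eqP.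
  by rewrite mulf_eq0 (negPf (canonical_coordinates_neq0 _)) => /eqP.
have [P clP] := exists_closed_point trdeg1 (proj1 ffx).
have [t mt genm] := nonsing P clP.
have E0 := derivation_zero_at_uniformizer clP trdeg1 mt genm ffx.
have [Dt0|nz_Dt] := eqVneq (D t : K) 0; first exact: E0.
have [dD_D dM_D dC_D] := dD; have [dD_d dM_d dC_d] := dd.
pose E z : Omega := (D t : K) *: d z - (D z : K) *: d t.
have dE : derivation iota E.
  split=> [a b|a b|c']; rewrite /E.
  - by rewrite dD_D dD_d scalerDr scalerDl opprD addrACA.
  - rewrite dM_D dM_d scalerDr scalerDl !scalerBr !scalerA opprD addrACA.
    by rewrite !(mulrC (D t)).
  - by rewrite dC_D dC_d scaler0 scale0r subrr.
have Et0 z : (D t : K) *: d z = (D z : K) *: d t.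
  by apply/eqP; rewrite -subr_eq0; apply/eqP; apply: (E0 _ E dE); rewrite /E subrr.
have omega0 : omega i0 = 0.
  apply: (scalerI nz_Dt); rewrite scaler0.
  have [m [a [b [_ _ Dom]]]] := reg_omega i0 P clP.
  have -> : (D t : K) *: omega i0 = (h (omega i0) : K) *: d t.
    rewrite Dom scaler_sumr linear_sum scaler_suml; apply: eq_bigr => j _.
    have -> : h (a j *: d (b j)) = a j * D (b j) by rewrite linearZ /= Dh.
    by rewrite scalerA (mulrC (D t)) -!scalerA Et0.
  by rewrite h_omega h_eta mulr0 scale0r.
move/eqP: omega0; rewrite Domega scaler_eq0 (negPf nz_eta) orbF.
by rewrite (negPf (canonical_coordinates_neq0 _)).
Qed.

End NoVectorFields.

Section InducedDerivation.

Variables (k : closedFieldType) (K : fieldType) (iota : {rmorphism k -> K}).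
Variables (g : nat) (w : 'I_g -> K) (B : 'M[k]_g).
Local Notation I := (hom_ideal iota w).

(** The only homogeneous component of [F] that can be nonzero is [F] itself. *)
Lemma hom_ideal_homog d F : F \is d.-homog -> I F <-> mmap iota w F = 0.
Proof.
move=> hF; split=> [/(_ d)|F0 e]; first by rewrite pihomog_dE.
have [->|ne_de] := eqVneq e d; first by rewrite pihomog_dE.
by rewrite (pihomog_ne0 _ hF) ?rmorph0 // eq_sym.
Qed.

Hypothesis ffw : is_function_field iota w.
Hypothesis tangentB : forall F, I F -> I (vector_field B F).

Local Notation ev := (mmap iota w).
Local Notation dB := (vector_field B).

(** The quotient rule defines [D] on [z = F(w) / H(w)], written so that only
    [z] and the values of the two derivatives occur.  Two presentations
    [F / H] and [F' / H'] of [z] give a form [F H' - F' H] in the ideal;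
    its image under the vector field is again in the ideal, which is exactly
    the equality of the two values. *)
Lemma induced_derivation : exists D : K -> K^o, derivation iota D /\
  forall d F H, F \is d.-homog -> H \is d.-homog -> ev H != 0 ->
    D (ev F / ev H) = (ev (dB F) - ev F / ev H * ev (dB H)) / ev H.
Proof.
have [_ frac] := ffw.
have /boolp.choice[D specD] : forall z, exists v, exists d F H,
   [/\ F \is d.-homog, H \is d.-homog, ev H != 0, z = ev F / ev H &
       v = (ev (dB F) - z * ev (dB H)) / ev H].
  move=> z; have [d [F [H [hF hH nzH Dz]]]] := frac z.
  by exists ((ev (dB F) - z * ev (dB H)) / ev H), d, F, H.
have DE d F H : F \is d.-homog -> H \is d.-homog -> ev H != 0 ->
    D (ev F / ev H) = (ev (dB F) - ev F / ev H * ev (dB H)) / ev H.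
  move=> hF hH nz_H; set z := ev F / ev H.
  have [e [F' [H' [hF' hH' nz_H' Dz ->]]]] := specD z.
  have hT : F * H' - F' * H \is (d + e)%N.-homog.
    by apply: rpredB; last rewrite addnC; apply: dhomogM.
  have DF : ev F = z * ev H by rewrite /z divfK.
  have DF' : ev F' = z * ev H' by rewrite Dz divfK.
  have /tangentB : I (F * H' - F' * H).
    apply/(hom_ideal_homog hT).
    by rewrite rmorphB !rmorphM /= DF DF'; ring.
  move/(hom_ideal_homog (vector_field_homog B hT)).
  rewrite vector_fieldB !vector_fieldM rmorphB !rmorphD !rmorphM /= DF DF'.
  move=> /eqP T0.
  apply/eqP; rewrite eqr_div // -subr_eq0 -oppr_eq0; apply: etrans T0.
  by congr (_ == _); ring.
exists D; split=> //; split=> [a b|a b|c].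
- have [d [F [H [hF hH nz_H Da]]]] := frac a.
  have [e [F' [H' [hF' hH' nz_H' Db]]]] := frac b.
  have DEa := DE _ _ _ hF hH nz_H; rewrite -Da in DEa.
  have DEb := DE _ _ _ hF' hH' nz_H'; rewrite -Db in DEb.
  have hN : F * H' + F' * H \is (d + e)%N.-homog.
    by apply: rpredD; last rewrite addnC; apply: dhomogM.
  have := DE _ _ _ hN (dhomogM hH hH').
  rewrite !vector_fieldD !vector_fieldM !rmorphD !rmorphM /= -addf_div // -Da -Db.
  rewrite mulf_neq0 // => /(_ isT) ->.
  by rewrite DEa DEb Da Db /GRing.scale /=; field; rewrite nz_H nz_H'.
- have [d [F [H [hF hH nz_H Da]]]] := frac a.
  have [e [F' [H' [hF' hH' nz_H' Db]]]] := frac b.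
  have DEa := DE _ _ _ hF hH nz_H; rewrite -Da in DEa.
  have DEb := DE _ _ _ hF' hH' nz_H'; rewrite -Db in DEb.
  have := DE _ _ _ (dhomogM hF hF') (dhomogM hH hH').
  rewrite !vector_fieldM !rmorphD !rmorphM /= -mulf_div // -Da -Db.
  rewrite mulf_neq0 // => /(_ isT) ->.
  by rewrite DEa DEb Da Db /GRing.scale /=; field; rewrite nz_H nz_H'.
- have := DE 0 c%:MP 1 (dhomogC _ c) (dhomog1 _ _).
  rewrite rmorph1 divr1 mmapC oner_neq0 => /(_ isT) ->.
  have dB1 : dB 1 = 0 by rewrite -mpolyC1 vector_fieldC.
  rewrite vector_fieldC dB1.
  by rewrite rmorph0 mulr0 subrr mul0r.
Qed.

End InducedDerivation.

Section Eigenvectors.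

Variables (k : closedFieldType) (K : fieldType) (iota : {rmorphism k -> K}).
Variables (g : nat) (w : 'I_g -> K) (B : 'M[k]_g).
Hypothesis free_w : forall c : 'I_g -> k, \sum_i iota (c i) * w i = 0 ->
  forall i, c i = 0.

(** The eigenvalue [l] is a root of the characteristic polynomial of a matrix
    over [k], hence lies in [k]; each row of [B - l] is then a linear relation
    between the [w i]. *)
Lemma eigenvector_scalar (l : K) : (exists i, w i != 0) ->
  (forall i, \sum_j iota (B i j) * w j = l * w i) -> exists c, B = c%:M.
Proof.
move=> [j nz_j] Bw.
have eig : eigenvalue (map_mx iota B^T) l.
  apply/eigenvalueP; exists (\row_i w i).
    apply/rowP => i; rewrite !mxE -Bw; apply: eq_bigr => i' _.
    by rewrite !mxE mulrC.
  by apply/eqP=> /rowP/(_ j); rewrite !mxE => /eqP; apply/negP.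
have [c Dl] : exists c, l = iota c.
  apply: algebraic_in_k; exists (char_poly B^T).
    by rewrite monic_neq0 ?char_poly_monic.
  by rewrite map_char_poly -eigenvalue_root_char.
exists c; apply/matrixP => i j'; apply/eqP; rewrite -subr_eq0; apply/eqP.
apply: (free_w (c := fun j' => B i j' - c%:M i j')).
under eq_bigr => i' _ do rewrite rmorphB mulrBl.
rewrite sumrB Bw Dl (bigD1 i) //= big1 => [|i' /negPf]; rewrite mxE.
  by rewrite eqxx addr0 subrr.
by rewrite eq_sym => ->; rewrite rmorph0 mul0r.
Qed.

End Eigenvectors.

Section PsiKernel.

Variables (k : closedFieldType) (K : fieldType) (iota : {rmorphism k -> K}).
Variables (n : nat) (x : 'I_n -> K) (hX : nonsingular_projective_curve iota x).
Variables (Omega : lmodType K) (d : K -> Omega).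
Hypothesis hOmega : kaehler_differentials iota d.
Variables (g : nat) (omega : 'I_g -> Omega).
Hypothesis homega : regular_differentials_basis iota d x omega.
Variable w : 'I_g -> K.
Hypothesis hw : canonical_coordinates omega w.
Hypothesis hi : closed_embedding iota x w.
Local Notation I := (hom_ideal iota w).

(** The vector field of [B] is tangent to [X] and induces a global vector
    field there, which is zero.  Evaluated at the ratios [w i / w j], its
    vanishing says that [w] is an eigenvector of [B]. *)
Lemma vector_field_preserving_ideal_scalar (B : 'M[k]_g) : (1 < g)%N ->
  (forall F, I F -> I (vector_field B F)) -> exists c, B = c%:M.
Proof.
move=> g_gt1 tangentB; have [ffx trdeg1 _] := hX.
have ffw := closed_embedding_function_field trdeg1 ffx hi.
have [D [dD DE]] := induced_derivation ffw tangentB.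
have regD P z : closed_point iota x P ->
    in_local_ring iota x P z -> in_local_ring iota x P (D z).
  move=> clP; have [xw _] := hi; have [Q clQ eqPQ] := xw P clP.
  move=> /eqPQ[e [F [H [hF hH HQ ->]]]]; apply/eqPQ.
  have nz_H := closed_point_neq0 clQ hH HQ; rewrite (DE e) //.
  exists (e + e)%N, (vector_field B F * H - F * vector_field B H), (H * H).
  split.
  - by apply: rpredB; apply: dhomogM => //; apply: vector_field_homog.
  - exact: dhomogM.
  - by rewrite mevalM mulf_neq0.
  - by rewrite rmorphB !rmorphM /=; field.
have D0 := no_global_vector_field hX hOmega homega hw g_gt1 dD regD.
have nz_w := canonical_coordinates_neq0 homega hw.
pose j := Ordinal (ltnW g_gt1).
have ev_form i : mmap iota w (linear_form B i) = \sum_l iota (B i l) * w l.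
  by rewrite rmorph_sum; apply: eq_bigr => l _; rewrite /= mmapZ mmapX mmap1U.
apply: (eigenvector_scalar (l := (\sum_l iota (B j l) * w l) / w j)
  (canonical_coordinates_free homega hw)); first by exists j.
move=> i; have := DE _ _ _ (dhomogXi _ i) (dhomogXi _ j).
rewrite !vector_fieldX !ev_form !mmapX !mmap1U nz_w D0 => /(_ isT) /esym/eqP.
rewrite mulf_eq0 invr_eq0 (negPf (nz_w j)) orbF subr_eq0 => /eqP ->.
by rewrite mulrC mulrA mulrAC.
Qed.

End PsiKernel.

(** * Normal sections, the group action and the cocycle *)

Section QuadricIdeal.

Variables (k : closedFieldType) (g : nat) (I : {mpoly k[g]} -> Prop).
Variables (r : nat) (A : 'I_r -> 'M[k]_g).
Hypothesis genI : generated_by_quadrics I A.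
Implicit Types (F H p : {mpoly k[g]}) (h : {mpoly k[g]} -> {mpoly k[g]}).

Lemma quadric_idealD F H : I F -> I H -> I (F + H).
Proof.
move=> /genI[a ->] /genI[b ->]; apply/genI; exists (fun i => a i + b i).
by rewrite -big_split; apply: eq_bigr => i _; rewrite mulrDl.
Qed.

Lemma quadric_idealM p F : I F -> I (p * F).
Proof.
move=> /genI[a ->]; apply/genI; exists (fun i => p * a i).
by rewrite mulr_sumr; apply: eq_bigr => i _; rewrite mulrA.
Qed.

Lemma quadric_idealN F : I F -> I (- F).
Proof. by rewrite -mulN1r; apply: quadric_idealM. Qed.

Lemma quadric_idealB F H : I F -> I H -> I (F - H).
Proof. by move=> IF IH; apply: quadric_idealD => //; apply: quadric_idealN. Qed.

Lemma quadric_ideal0 : I 0.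
Proof.
apply/genI; exists (fun=> 0); rewrite big1 // => i _; exact: mul0r.
Qed.

Lemma quadric_ideal_quad i : I (quad (A i)).
Proof.
apply/genI; exists (fun j => (j == i)%:R).
by rewrite (bigD1 i) //= eqxx mul1r big1 ?addr0 // => j /negPf ->; rewrite mul0r.
Qed.

Lemma eq_mod_sym F H : eq_mod I F H -> eq_mod I H F.
Proof. by rewrite /eq_mod => /quadric_idealN; rewrite opprB. Qed.

Lemma eq_mod_trans F H p : eq_mod I F H -> eq_mod I H p -> eq_mod I F p.
Proof. by rewrite /eq_mod => FH /(quadric_idealD FH); rewrite addrA subrK. Qed.

Lemma eq_modD F F' H H' :
  eq_mod I F F' -> eq_mod I H H' -> eq_mod I (F + H) (F' + H').
Proof. by rewrite /eq_mod opprD addrACA; apply: quadric_idealD. Qed.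

Lemma quadric_ideal_ind (Q : {mpoly k[g]} -> Prop) :
  Q 0 -> (forall F H, I F -> I H -> Q F -> Q H -> Q (F + H)) ->
  (forall p i, Q (p * quad (A i))) -> forall F, I F -> Q F.
Proof.
move=> Q0 QD Qq F /genI[c ->].
suff [] : I (\sum_i c i * quad (A i)) /\ Q (\sum_i c i * quad (A i)) by [].
elim/big_ind: _ => [|F1 F2 [I1 Q1] [I2 Q2]|i _].
- by split=> //; apply: quadric_ideal0.
- by split; [apply: quadric_idealD | apply: QD].
- by split=> //; apply: quadric_idealM; apply: quadric_ideal_quad.
Qed.

Lemma vector_field_preserves B :
  (forall i, I (vector_field B (quad (A i)))) ->
  forall F, I F -> I (vector_field B F).
Proof.
move=> IBA; apply: quadric_ideal_ind => [|F H _ _ IF IH|p i].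
- by rewrite vector_field0; apply: quadric_ideal0.
- by rewrite vector_fieldD; apply: quadric_idealD.
- rewrite vector_fieldM; apply: quadric_idealD; apply: quadric_idealM => //.
  exact: quadric_ideal_quad.
Qed.

(** Both sides are [S]-linear modulo [I] on [I] -- for the derivation, the
    extra term in the product rule is a multiple of an element of [I] -- and
    they agree on the generators. *)
Lemma represents_psi_vector_field B h : represents_psi I A B h ->
  forall F, I F -> eq_mod I (h F) (vector_field B F).
Proof.
case=> [[hD hM _] hA]; apply: quadric_ideal_ind => [|F H IF IH FB HB|p i].
- have := hM 0 0 quadric_ideal0; rewrite !mul0r => h0.
  by rewrite vector_field0.
- rewrite vector_fieldD; apply: eq_mod_trans (hD _ _ IF IH) _.
  exact: eq_modD.
- apply: eq_mod_trans (hM _ _ (quadric_ideal_quad i)) _.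
  rewrite vector_fieldM vector_field_quad /eq_mod [X in _ - X]addrC opprD addrA.
  rewrite -mulrBr; apply: quadric_idealB; apply: quadric_idealM; first exact: hA.
  exact: quadric_ideal_quad.
Qed.

End QuadricIdeal.

Lemma linear_formB (k : closedFieldType) g (B B' : 'M[k]_g) i :
  linear_form (B - B') i = linear_form B i - linear_form B' i.
Proof.
by rewrite -sumrB; apply: eq_bigr => j _; rewrite !mxE scalerBl.
Qed.

Lemma vector_fieldBl (k : closedFieldType) g (B B' : 'M[k]_g) F :
  vector_field (B - B') F = vector_field B F - vector_field B' F.
Proof.
by rewrite -sumrB; apply: eq_bigr => i _; rewrite linear_formB mulrBl.
Qed.

Lemma subst_linM (k : closedFieldType) g (M N : 'M[k]_g) F :
  subst_lin M (subst_lin N F) = subst_lin (N *m M) F.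
Proof.
rewrite /subst_lin !(comp_mpolyEX F) raddf_sum; apply: eq_bigr => m _.
rewrite /= comp_mpolyZ !comp_mpolyX rmorph_prod; congr (_ *: _).
apply: eq_bigr => i _; rewrite /= rmorphXn /= !tnth_mktuple; congr (_ ^+ _).
rewrite raddf_sum /=.
under eq_bigr => j _ do
  rewrite comp_mpolyZ comp_mpolyXU -tnth_nth tnth_mktuple scaler_sumr.
rewrite exchange_big; apply: eq_bigr => l _ /=.
by rewrite mxE scaler_suml; apply: eq_bigr => j _; rewrite scalerA.
Qed.

Section Action.

Variables (k : closedFieldType) (g : nat) (G : finGroupType).
Variable rho : mx_representation k [set: G] g.

Lemma rhoM s t : rho (s * t)%g = rho s *m rho t.
Proof. by rewrite repr_mxM ?inE. Qed.

Lemma rho1 : rho 1%g = 1%:M.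
Proof. exact: repr_mx1. Qed.

Lemma actSM s t F : actS rho (s * t)%g F = actS rho s (actS rho t F).
Proof. by rewrite /actS subst_linM invMg rhoM. Qed.

Lemma actSB s F H : actS rho s (F - H) = actS rho s F - actS rho s H.
Proof. exact: comp_mpolyB. Qed.

(** This is an equality of maps on [S] and not only modulo [I]: the terms
    containing [f] at [actS rho s^-1 F] cancel, whatever [f] is. *)
Lemma deltaM f s t F :
  delta rho f (s * t)%g F =
    delta rho f s F + actS rho s (delta rho f t (actS rho s^-1%g F)).
Proof.
rewrite /delta /conj_map invMg !actSM actSB [RHS]addrC addrA.
by congr (_ - _); rewrite subrK.
Qed.

Lemma actS_vector_field_quad s B A :
  actS rho s (vector_field B (actS rho s^-1%g (quad A))) =
    vector_field (Ad rho s B) (quad A).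
Proof.
have rhoK : rho s *m rho s^-1%g = 1%:M by rewrite -rhoM mulgV rho1.
have rhoKT : (rho s^-1%g)^T *m (rho s)^T = 1%:M.
  by rewrite -trmx_mul rhoK trmx1.
rewrite /actS invgK subst_lin_quad !vector_field_quad subst_lin_quad /Ad.
congr (quad _); rewrite !trmx_mul mulmxDr mulmxDl !mulmxA rhoKT mul1mx.
congr (_ + _).
by rewrite -(mulmxA _ (rho s)) rhoK mulmx1.
Qed.

End Action.

Section CanonicalAction.

Variables (k : closedFieldType) (K : fieldType) (iota : {rmorphism k -> K}).
Variables (n : nat) (x : 'I_n -> K) (hX : nonsingular_projective_curve iota x).
Variables (Omega : lmodType K) (d : K -> Omega).
Variables (g : nat) (omega : 'I_g -> Omega).
Hypothesis homega : regular_differentials_basis iota d x omega.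
Variable w : 'I_g -> K.
Hypothesis hw : canonical_coordinates omega w.
Variables (r : nat) (A : 'I_r -> 'M[k]_g).
Hypothesis hAgen : generated_by_quadrics (hom_ideal iota w) A.
Variables (G : finGroupType) (act : G -> {rmorphism K -> K}).
Hypothesis hG : automorphism_group iota x act.
Variable actO : G -> {additive Omega -> Omega}.
Hypothesis hactO : induced_on_differentials d act actO.
Variable rho : mx_representation k [set: G] g.
Hypothesis hrho : forall (s : G) (i : 'I_g),
  actO s (omega i) = \sum_j iota (rho s^-1%g i j) *: omega j.

(** At any closed point [omega i] is a sum of terms [a *: d b], on which the
    action is prescribed. *)
Lemma actO_semilinear s c i : actO s (c *: omega i) = act s c *: actO s (omega i).
Proof.
have [ffx trdeg1 _] := hX.
have [P clP] := exists_closed_point trdeg1 (proj1 ffx).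
have [reg_omega _ _] := homega; have [m [a [b [_ _ ->]]]] := reg_omega i P clP.
rewrite scaler_sumr !raddf_sum; apply: eq_bigr => j _ /=.
by rewrite scalerA !hactO rmorphM scalerA.
Qed.

(** The image of [omega i] under [s] is the [i]-th entry of [rho (s^-1) w]
    times [eta].  On the other hand [omega i] is [w i / w j] times [omega j],
    so by semilinearity its image is proportional to [act s (w i)], with a
    factor independent of [i]. *)
Lemma act_coordinates s (j : 'I_g) : exists c : K, forall i,
  \sum_l iota (rho s^-1%g i l) * w l = c * act s (w i).
Proof.
have nz_w := canonical_coordinates_neq0 homega hw.
have [eta nz_eta Domega] := hw.
pose w' i := \sum_l iota (rho s^-1%g i l) * w l.
have Dw' i : actO s (omega i) = w' i *: eta.
  by rewrite hrho scaler_suml; apply: eq_bigr => l _; rewrite Domega scalerA.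
exists (w' j / act s (w j)) => i; rewrite -/(w' i).
suff : w' i *: eta = (w' j / act s (w j) * act s (w i)) *: eta.
  move/eqP; rewrite -subr_eq0 -scalerBl scaler_eq0 (negPf nz_eta) orbF subr_eq0.
  by move/eqP.
rewrite -Dw'.
have -> : omega i = (w i / w j) *: omega j by rewrite !Domega scalerA divfK.
rewrite actO_semilinear Dw' scalerA fmorph_div; congr (_ *: _).
by rewrite mulrC mulrA mulrAC.
Qed.

(** It is enough to treat the generators, and a quadric that vanishes at [w]
    vanishes at [act s w], hence at the proportional point [rho (s^-1) w]. *)
Lemma hom_ideal_actS s (j : 'I_g) F :
  hom_ideal iota w F -> hom_ideal iota w (actS rho s F).
Proof.
move=> /hAgen[p ->]; have [c Dc] := act_coordinates s j.
suff IA i : hom_ideal iota w (actS rho s (quad (A i))).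
  rewrite /actS /subst_lin raddf_sum.
  elim/big_ind: _ => [|F1 F2|i _]; first exact: (quadric_ideal0 hAgen).
    exact: (quadric_idealD hAgen).
  by rewrite /= rmorphM /=; apply: (quadric_idealM hAgen _ (IA i)).
rewrite /actS subst_lin_quad; apply/(hom_ideal_homog iota w (quad_homog _)).
have ev_sum (L : 'I_g -> {mpoly k[g]}) :
    mmap iota w (\sum_a \sum_b A i a b *: (L a * L b)) =
    \sum_a \sum_b iota (A i a b) * (mmap iota w (L a) * mmap iota w (L b)).
  rewrite rmorph_sum; apply: eq_bigr => a _; rewrite /= rmorph_sum.
  by apply: eq_bigr => b _; rewrite /= mmapZ rmorphM.
have [actX _ _] := hG; have [_ actC _ _] := actX s.
have evL a : mmap iota w (linear_form (rho s^-1%g) a) = c * act s (w a).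
  by rewrite -Dc rmorph_sum; apply: eq_bigr => l _; rewrite /= mmapZ mmapX mmap1U.
have : mmap iota w (quad (A i)) = 0.
  apply/(hom_ideal_homog iota w (quad_homog (A i))).
  exact: (quadric_ideal_quad hAgen i).
move/(congr1 (fun z => c ^+ 2 * act s z)); rewrite rmorph0 mulr0 => <-.
rewrite -sum_linear_forms /quad !ev_sum rmorph_sum mulr_sumr.
apply: eq_bigr => a _; rewrite [in RHS]rmorph_sum mulr_sumr; apply: eq_bigr => b _.
by rewrite !evL !rmorphM /= actC !mmapX !mmap1U; ring.
Qed.

End CanonicalAction.

Theorem proposition32
  (* the curve X, with function field K, embedded in some projective space *)
  (k : closedFieldType) (hchar : 2%N \notin [pchar k])
  (K : fieldType) (iota : {rmorphism k -> K})
  (n : nat) (x : 'I_n -> K) (hX : nonsingular_projective_curve iota x)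
  (hnh : ~ hyperelliptic iota)
  (* a basis omega of H^0(X, Omega_X); the genus is g *)
  (Omega : lmodType K) (d : K -> Omega) (hOmega : kaehler_differentials iota d)
  (g : nat) (hg : (3 <= g)%N)
  (omega : 'I_g -> Omega)
  (homega : regular_differentials_basis iota d x omega)
  (* the canonical embedding *)
  (w : 'I_g -> K) (hw : canonical_coordinates omega w)
  (hi : closed_embedding iota x w)
  (* the quadrics generating the canonical ideal *)
  (A : 'I_('C(g - 2, 2)) -> 'M[k]_g)
  (hAsym : forall i, (A i)^T = A i)
  (hAfree : forall c : 'I_('C(g - 2, 2)) -> k,
      \sum_i c i *: A i = 0 -> forall i, c i = 0)
  (hAgen : generated_by_quadrics (hom_ideal iota w) A)
  (* the finite group G of automorphisms of X *)
  (G : finGroupType) (act : G -> {rmorphism K -> K})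
  (hG : automorphism_group iota x act)
  (actO : G -> {additive Omega -> Omega})
  (hactO : induced_on_differentials d act actO)
  (rho : mx_representation k [set: G] g)
  (hrho : forall (s : G) (i : 'I_g),
      actO s (omega i) = \sum_j iota (rho s^-1%g i j) *: omega j)
  (* a G-invariant class [f] in H^1(X, T_X) *)
  (f : {mpoly k[g]} -> {mpoly k[g]})
  (hf : normal_section (hom_ideal iota w) f)
  (hfG : invariant_class rho (hom_ideal iota w) A f) :
  exists B : G -> 'M[k]_g,
    [/\ forall (s : G) (i : 'I_('C(g - 2, 2))),
          maps_mod_span (hom_ideal iota w) A (delta rho f s) (A i)
            (A i *m B s + (B s)^T *m A i),
        (* the class of B s modulo scalar matrices is determined by f *)
        forall (s : G) (B' : 'M[k]_g),
          (forall i, maps_mod_span (hom_ideal iota w) A (delta rho f s) (A i)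
            (A i *m B' + B'^T *m A i)) ->
          exists c : k, B' = B s + c%:M
      & exists lambda : G -> G -> k, forall s t : G,
          B (s * t)%g = B s + Ad rho s (B t) + (lambda s t)%:M].
Proof.
have g_gt1 : (1 < g)%N := ltnW hg.
have j : 'I_g := Ordinal (ltnW g_gt1).
set I := hom_ideal iota w in hf hfG *.
have kernel : forall C : 'M[k]_g, (forall i, I (vector_field C (quad (A i)))) ->
    exists c, C = c%:M.
  move=> C IC.
  apply: (vector_field_preserving_ideal_scalar hX hOmega homega hw hi g_gt1).
  exact: (vector_field_preserves hAgen).
have /boolp.choice[B psiB] : forall s, exists B, exists2 h,
    represents_psi I A B h & eq_hom I (delta rho f s) h by exact: hfG.
have deltaE s F : I F -> eq_mod I (delta rho f s F) (vector_field (B s) F).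
  move=> IF; have [h hB eq_h] := psiB s.
  apply: (eq_mod_trans hAgen) (eq_h F IF) _.
  exact: (represents_psi_vector_field hAgen hB).
have IA := quadric_ideal_quad hAgen.
exists B; split.
- move=> s i; exists (A i *m B s + (B s)^T *m A i); split.
  + by rewrite linearD /= !trmx_mul trmxK hAsym addrC.
  + by rewrite -vector_field_quad; apply: deltaE; apply: IA.
  + by exists (fun=> 0); rewrite subrr big1 // => l _; rewrite scale0r.
- move=> s B' mapB'; have [i|c Dc] := kernel (B' - B s).
    have [C [_ eqC [c Dc]]] := mapB' i.
    have IC : I (quad C - vector_field B' (quad (A i))).
      rewrite vector_field_quad -quadB Dc.
      elim/big_ind: _ => [|M N IM IN|l _].
      - by rewrite -(subrr 0) quadB subrr; apply: (quadric_ideal0 hAgen).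
      - by rewrite quadD; apply: (quadric_idealD hAgen).
      - by rewrite quadZ -mul_mpolyC; apply: (quadric_idealM hAgen); apply: IA.
    rewrite vector_fieldBl; apply: (eq_mod_sym hAgen).
    apply: (eq_mod_trans hAgen) (eq_mod_sym hAgen (deltaE s _ (IA i))) _.
    exact: (eq_mod_trans hAgen) eqC IC.
  by exists c; rewrite -Dc addrC subrK.
- have cocycle st : exists c,
      B (st.1 * st.2)%g - B st.1 - Ad rho st.1 (B st.2) = c%:M.
    case: st => s t /=; apply: kernel => i; rewrite !vector_fieldBl.
    have actI := hom_ideal_actS hX homega hw hAgen hG hactO hrho.
    have IA' := actI s^-1%g j _ (IA i).
    have := deltaE (s * t)%g _ (IA i); rewrite deltaM.
    have := deltaE s _ (IA i); have := actI s j _ (deltaE t _ IA').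
    rewrite actSB actS_vector_field_quad /eq_mod => I1 I2 I3.
    have /(quadric_idealB hAgen) := quadric_idealD hAgen I1 I2; move/(_ _ I3).
    by congr I; ring.
  have [c Dc] := boolp.choice cocycle; exists (fun s t => c (s, t)) => s t.
  by rewrite -(Dc (s, t)) /= -(addrA (B (s * t)%g)) -opprD [RHS]addrC subrK.
Qed.
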